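(* Let $d,N\ge 1$ and $1\le n\le d+1$ be integers, let $\kappa_n>0$, and let $x_1,\dots,x_N:[0,\infty)\to\mathbb{R}^d$ be a solution of the gradient flow $$\dot x_i=-\nabla_{x_i}\mathcal V_n(\mathcal X)=-\frac{\kappa_n}{2N^n}\sum_{j_1,\dots,j_n=1}^N\nabla_{x_i}\mathrm{Vol}_n(x_{j_1},\dots,x_{j_n},x_i)^2,\quad t>0,\qquad x_i(0)=x_i^0\in\mathbb{R}^d,\quad i=1,\dots,N.$$ Then there exists an $(n-1)$-dimensional affine subspace $P^\infty\subset\mathbb{R}^d$ such that for every $i\in\{1,\dots,N\}$ the limit $x_i^\infty:=\lim_{t\to\infty}x_i(t)$ exists and $x_i^\infty\in P^\infty$.
   Context: For $y_1,\dots,y_{n+1}\in\mathbb{R}^d$, $\mathrm{Vol}_n(y_1,\dots,y_{n+1})\ge 0$ denotes the $n$-dimensional volume of the (possibly degenerate) $n$-simplex with vertices $y_1,\dots,y_{n+1}$. Explicitly, with $B_{ij}=\|y_i-y_j\|^2$, $$\mathrm{Vol}_n(y_1,\dots,y_{n+1})^2=\frac{(-1)^{n+1}}{2^n(n!)^2}\det\begin{bmatrix}0&\mathbf 1^\top\\ \mathbf 1&B\end{bmatrix},\qquad \mathbf 1=(1,\dots,1)^\top\in\mathbb{R}^{n+1}.$$ In particular it is zero when two vertices coincide. For $\mathcal X=(x_1,\dots,x_N)\in(\mathbb{R}^d)^N$, the $n$-simplex potential is $$\mathcal V_n(\mathcal X)=\frac{\kappa_n}{2(n+1)N^n}\sum_{j_1,\dots,j_{n+1}=1}^N\mathrm{Vol}_n(x_{j_1},\dots,x_{j_{n+1}})^2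 ,$$ where $\kappa_n$ is the attractive coupling strength. *)

(* Defs.v *)
From HB Require Import structures.
From mathcomp Require Import all_boot all_order all_algebra.
From mathcomp Require Import all_classical all_reals all_analysis.
Set Implicit Arguments.
Unset Strict Implicit.
Unset Printing Implicit Defensive.
Import Order.TTheory GRing.Theory Num.Theory.
Import numFieldNormedType.Exports.
Local Open Scope classical_set_scope.
Local Open Scope ring_scope.

(* The library norm on 'rV[R]_d is the sup norm, so the squared Euclidean norm
   is spelled out.  The topology is the same, hence so are limits and
   derivatives. *)
Definition sqnorm2 (R : realType) (d : nat) (v : 'rV[R]_d) : R :=
  \sum_(k < d) v 0 k ^+ 2.

Definition sqdist_mx (R : realType) (d n : nat) (y : 'I_n.+1 -> 'rV[R]_d) :
    'M[R]_n.+1 :=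
  \matrix_(i, j) sqnorm2 (y i - y j).

Definition cayley_menger_mx (R : realType) (d n : nat)
    (y : 'I_n.+1 -> 'rV[R]_d) : 'M[R]_(1 + n.+1) :=
  block_mx (0 : 'M[R]_1) (const_mx 1) (const_mx 1) (sqdist_mx y).

(* The Cayley-Menger formula gives the square of the volume; the radicand is
   nonnegative for points of Euclidean space. *)
Definition simplex_vol (R : realType) (d n : nat) (y : 'I_n.+1 -> 'rV[R]_d) :
    R :=
  Num.sqrt ((-1) ^+ n.+1 / (2 ^+ n * n`!%:R ^+ 2) * \det (cayley_menger_mx y)).

Definition simplex_potential (R : realType) (d N n : nat) (kappa : R)
    (X : 'I_N -> 'rV[R]_d) : R :=
  kappa / (2 * n.+1%:R * N%:R ^+ n) *
  \sum_(j : {ffun 'I_n.+1 -> 'I_N}) simplex_vol (fun a => X (j a)) ^+ 2.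

Definition gradient (R : realType) (d : nat) (f : 'rV[R]_d -> R)
    (p : 'rV[R]_d) : 'rV[R]_d :=
  \row_(k < d) 'D_(delta_mx 0 k) f p.

Definition gradient_at (R : realType) (d N : nat)
    (F : ('I_N -> 'rV[R]_d) -> R) (i : 'I_N) (X : 'I_N -> 'rV[R]_d) :
    'rV[R]_d :=
  gradient (fun y => F (dfwith X i y)) (X i).

(* The functions are total on R; only their values on [0, +oo[ matter. *)
Definition gradient_flow_solution (R : realType) (d N n : nat) (kappa : R)
    (x0 : 'I_N -> 'rV[R]_d) (x : 'I_N -> R -> 'rV[R]_d) : Prop :=
  forall i : 'I_N,
    [/\ x i 0 = x0 i,
        {within `[0, +oo[%classic, continuous (x i)} &
        forall t : R, 0 < t ->
          is_derive t (1 : R) (x i)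
            (- gradient_at (@simplex_potential R d N n kappa) i
                 (fun j => x j t))].

Definition affine_subspace (R : realType) (d k : nat) (P : set 'rV[R]_d) :
    Prop :=
  exists (p : 'rV[R]_d) (W : {vspace 'rV[R]_d}),
    \dim W = k /\ P = [set y | y - p \in W].

(* Main.v *)
Require Import Defs.
From HB Require Import structures.
From mathcomp Require Import all_boot all_order all_algebra.
From mathcomp Require Import all_classical all_reals all_analysis.
From mathcomp Require Import perm complex ring lra.
Import Order.TTheory GRing.Theory Num.Theory.
Import numFieldNormedType.Exports.
Local Open Scope classical_set_scope.
Local Open Scope ring_scope.

(** Let A be the N x d matrix of the positions relative to their mean, and
let M = A A^T be its Gram matrix.

The Cayley-Menger formula says that n!^2 times the squared volume of a simplex
is the sum of all the cofactors of the Gram matrix of its vertices.  Summed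
over all (n+1)-tuples of points, these cofactors give the derivative, in the
direction of the all-ones matrix, of the sum of the principal minors of M.
Since the all-ones vector is in the kernel of M, that derivative is a multiple
of the sum of the minors of size n: up to a positive constant the potential is
e_n(M), the n-th elementary symmetric function of the eigenvalues of M
([simplex_potentialE]).  The derivative of e_n at M is the Newton transform
T(M) = e_(n-1)(M) - e_(n-2)(M) M + ... + (-1)^(n-1) M^(n-1), hence the flow is
A' = - g T(M) A with g > 0, and the mean is constant
([gradient_simplex_potential], [positionE_centered]).

As T(M) is a polynomial in M, the eigenvectors of M do not move.  Precisely, if
the orthogonal matrix Q diagonalizes M(0), then B = Q A solves the same
equation, and the off-diagonal entries of L = B B^T = Q M Q^T satisfy a linear
differential inequality with zero initial value, so that L(t) stays diagonal
([gram_flow_diagonal]).  Row p of B then obeys B_p' = - g tau_p B_p, where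
tau_p >= 0 is the elementary symmetric function of degree n-1 of the
eigenvalues other than lambda_p = |B_p|^2.  The square of each entry of B is
therefore nonincreasing, and a continuous function with nonincreasing square
converges ([sqr_nonincreasing_cvg]).

Finally lambda_p converges and so does its derivative - 2 g tau_p lambda_p,
which must tend to 0.  If n of the limit eigenvalues were positive, one of them
would have lambda_p tau_p > 0.  So at most n-1 rows of the limit of B are
nonzero ([gram_flow_cvg]), and the limits of the x_i differ from the mean by
linear combinations of these rows.

The algebra of e_n rests on one recursion: the derivative in the direction H
of the sum of the principal minors of size m+1 is expressed by that of the sum
of the minors of size m in the direction H M ([minor_sum_diffS]).  It yields
the Newton transform as well as the formula for e_(m+1) as a trace
([minor_sum_diff_newton], [minor_sumS]). *)

Set Implicit Arguments.
Unset Strict Implicit.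
Unset Printing Implicit Defensive.

(** * Bordered determinants and the derivative of a determinant *)

(** Multiplying on the right by the block matrix with columns
(det G, - adj G c) and (0, 1) clears the lower left block; the factor det G so
introduced is cancelled. *)
Lemma det_bordered_nonsingular (F : idomainType) m (h : 'M[F]_1)
    (r : 'M[F]_(1, m)) (c : 'M[F]_(m, 1)) (G : 'M[F]_m) : \det G != 0 ->
  \det (block_mx h r c G) = h 0 0 * \det G - (r *m \adj G *m c) 0 0.
Proof.
move=> G0; apply: (mulIf G0).
have <- : \det (block_mx (\det G)%:M 0 (- (\adj G *m c)) (1%:M : 'M[F]_m)) =
    \det G.
  by rewrite (@det_lblock _ 1) det1 mulr1 det_scalar1.
rewrite -det_mulmx (@mulmx_block _ 1 m 1 m 1 m) !mulmx0 !mulmx1 !add0r.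
rewrite !mulmxN !mulmxA mul_mx_adj !mul_mx_scalar mul_scalar_mx subrr.
rewrite (@det_ublock _ 1) det_mx11 (@det_lblock _ 1) det1 mulr1 det_scalar1.
by rewrite !mxE [_ * h 0 0]mulrC.
Qed.

(** Both sides are polynomial in the entries of G, so the nonsingular case
applied to X + G, which has monic determinant, can be specialized at X = 0. *)
Lemma det_bordered (F : idomainType) m (h : 'M[F]_1) (r : 'M[F]_(1, m))
    (c : 'M[F]_(m, 1)) (G : 'M[F]_m) :
  \det (block_mx h r c G) = h 0 0 * \det G - (r *m \adj G *m c) 0 0.
Proof.
pose ev : {rmorphism {poly F} -> F} := horner_eval (0 : F).
pose C : {rmorphism F -> {poly F}} := @polyC F.
have evE p : ev p = p.[0] by [].
have evC p q (A : 'M[F]_(p, q)) : map_mx ev (map_mx C A) = A.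
  by apply/matrixP=> i j; rewrite !mxE evE hornerC.
pose G' := 'X%:M + map_mx C G.
have evG : map_mx ev G' = G.
  apply/matrixP=> i j; rewrite !mxE evE hornerD hornerC hornerMn.
  by rewrite hornerX mul0rn add0r.
have G'0 : \det G' != 0.
  have -> : G' = char_poly_mx (- G).
    by rewrite /char_poly_mx map_mxN opprK.
  exact/monic_neq0/char_poly_monic.
have := congr1 ev (det_bordered_nonsingular (map_mx C h) (map_mx C r) (map_mx C c) G'0).
rewrite -det_map_mx map_block_mx !evC evG => ->.
rewrite rmorphB rmorphM /= -det_map_mx evG.
congr (_ * _ - _); first by rewrite !mxE evE hornerC.
transitivity (map_mx ev (map_mx C r *m \adj G' *m map_mx C c) 0 0).
  by rewrite [RHS]mxE.
by rewrite !map_mxM map_mx_adj !evC evG.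
Qed.

Lemma deriv_prod (F : nzRingType) (I : eqType) (s : seq I)
    (f : I -> {poly F}) : uniq s ->
  (\prod_(i <- s) f i)^`() =
  \sum_(k <- s) \prod_(i <- s) (if i == k then (f i)^`() else f i).
Proof.
elim: s => [|a s IHs] /=; first by rewrite !big_nil derivC.
move=> /andP[as_ us]; rewrite !big_cons derivM IHs // eqxx; congr (_ + _).
  congr (_ * _); apply: eq_big_seq => i si.
  by case: eqVneq => // ia; rewrite -ia si in as_.
rewrite big_distrr; apply: eq_big_seq => k sk /=; rewrite big_cons.
by case: eqVneq => // ak; rewrite ak sk in as_.
Qed.

Lemma tr_adj_mul (F : comNzRingType) m (A B : 'M[F]_m) (b : 'I_m) :
  (\adj A *m B) b b =
  \det (\matrix_(i, j) (if j == b then B i j else A i j)).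
Proof.
rewrite (expand_det_col _ b) mxE; apply: eq_bigr => i _.
rewrite !mxE eqxx mulrC; congr (_ * _); rewrite /cofactor.
congr (_ * \det _); apply/matrixP=> p q; rewrite !mxE.
by rewrite [lift _ _ == _]eq_sym (negPf (neq_lift _ _)).
Qed.

Lemma tr_adj_mul_row (F : comNzRingType) m (A B : 'M[F]_m) (b : 'I_m) :
  (B *m \adj A) b b =
  \det (\matrix_(i, j) (if i == b then B i j else A i j)).
Proof.
rewrite (expand_det_row _ b) mxE; apply: eq_bigr => i _.
rewrite !mxE eqxx; congr (_ * _); rewrite /cofactor.
congr (_ * \det _); apply/matrixP=> p q; rewrite !mxE.
by rewrite [lift _ _ == _]eq_sym (negPf (neq_lift _ _)).
Qed.

(** Jacobi formula: in the Leibniz expansion the product rule differentiates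
one row at a time, and expanding along that row gives the cofactors. *)
Lemma deriv_det (F : comNzRingType) m (A : 'M[{poly F}]_m) :
  (\det A)^`() = \tr (\adj A *m map_mx (@deriv F) A).
Proof.
rewrite mxtrace_mulC /mxtrace; under [RHS]eq_bigr do rewrite tr_adj_mul_row.
rewrite /determinant raddf_sum exchange_big /=; apply: eq_bigr => s _.
rewrite -mulr_sumr.
have -> : forall (b : bool) (p : {poly F}), ((-1) ^+ b * p)^`() = (-1) ^+ b * p^`().
  by case=> p; rewrite ?expr0 ?expr1 ?mul1r // !mulN1r derivN.
congr (_ * _).
rewrite deriv_prod ?index_enum_uniq //.
apply: eq_bigr => k _; apply: eq_bigr => i _; rewrite !mxE.
by case: eqVneq.
Qed.

(** * Sums of principal minors over tuples of indices *)

Section MinorSums.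
Variables (F : numDomainType) (N : nat).
Implicit Types (M H : 'M[F]_N).

(** Every principal minor of size m is counted m! times and repeated indices
contribute 0, so this is m! times the m-th elementary symmetric function of the
eigenvalues.  Tuples are the index set of the potential. *)
Definition minor_sum m M : F :=
  \sum_(j : {ffun 'I_m -> 'I_N}) \det (mxsub j j M).

(** By the Jacobi formula this is the directional derivative of
[minor_sum m] at M along H. *)
Definition minor_sum_diff m M H : F :=
  \sum_(j : {ffun 'I_m -> 'I_N}) \tr (\adj (mxsub j j M) *m mxsub j j H).

(** m! times the Newton transform of order m; that transform is the coefficient
of X^m in the adjugate of 1 + X M. *)
Fixpoint newton_mx m M : 'M[F]_N :=
  if m is m'.+1 then
    (\tr (newton_mx m' M *m M))%:M - m%:R *: (M *m newton_mx m' M)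
  else 1%:M.

Lemma minor_sum_diff_self m M : minor_sum_diff m M M = m%:R * minor_sum m M.
Proof.
rewrite /minor_sum_diff /minor_sum mulr_sumr; apply: eq_bigr => j _.
by rewrite mul_adj_mx mxtrace_scalar mulr_natl.
Qed.

Lemma det_mxsub_perm m (s : {perm 'I_m}) (A : 'M[F]_m) :
  \det (mxsub s s A) = \det A.
Proof.
have -> : mxsub s s A = row_perm s (col_perm s A).
  by apply/matrixP=> i j; rewrite !mxE.
rewrite row_permE col_permE !det_mulmx !det_perm odd_permV.
by rewrite mulrCA -signr_addb addbb mulr1.
Qed.

(** Each of the m+1 columns contributes the same amount, since permuting the
entries of a tuple permutes rows and columns alike. *)
Lemma minor_sum_diff_col m M H : minor_sum_diff m.+1 M H =
  m.+1%:R * \sum_(j : {ffun 'I_m.+1 -> 'I_N})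
    (\adj (mxsub j j M) *m mxsub j j H) 0 0.
Proof.
rewrite /minor_sum_diff /mxtrace exchange_big /=.
set S := \sum_(j : {ffun _}) _; transitivity (\sum_(b < m.+1) S); last first.
  by rewrite sumr_const card_ord mulr_natl.
apply: eq_bigr => b _; rewrite /S.
pose s : {perm 'I_m.+1} := tperm 0 b.
pose g (j : {ffun 'I_m.+1 -> 'I_N}) := [ffun a => j (s a)].
have gK : involutive g.
  by move=> j; apply/ffunP=> a; rewrite !ffunE tpermK.
rewrite (reindex g) /=; last by exists g => j _; apply: gK.
apply: eq_bigr => j _; rewrite !tr_adj_mul.
rewrite -[RHS](det_mxsub_perm s); congr (\det _); apply/matrixP=> p q.
by rewrite !mxE !ffunE -(inj_eq (@perm_inj _ s)) tpermR.
Qed.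

Definition ffun_cons m (u : 'I_N * {ffun 'I_m -> 'I_N}) :
    {ffun 'I_m.+1 -> 'I_N} :=
  [ffun a => if @fintype.split 1 m a is inr b then u.2 b else u.1].

Lemma sum_ffun_cons m (f : {ffun 'I_m.+1 -> 'I_N} -> F) :
  \sum_j f j = \sum_j \sum_p f (@ffun_cons m (p, j)).
Proof.
rewrite exchange_big pair_big /= (reindex (@ffun_cons m)) /=; last first.
  pose h (j : {ffun 'I_m.+1 -> 'I_N}) :=
    (j (lshift m (0 : 'I_1)), [ffun b => j (@rshift 1 m b)]).
  exists h => [[p j] _|j _]; rewrite /h /ffun_cons.
    congr pair; first by rewrite ffunE (unsplitK (inl _ _)).
    by apply/ffunP=> b; rewrite !ffunE (unsplitK (inr _ _)).
  apply/ffunP=> a; rewrite ffunE /=.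
  rewrite -[in RHS](@splitK 1 m a).
  by case: (@fintype.split 1 m a) => b /=; rewrite ?ffunE // ord1.
by apply: eq_bigr => -[].
Qed.

(** After [minor_sum_diff_col] only the first column carries H.  The matrix is
then bordered by the row of M and the column of H of index p, and in
[det_bordered] the sum over p of the border terms is the product H M. *)
Lemma minor_sum_diffS m M H : minor_sum_diff m.+1 M H =
  m.+1%:R * (\tr H * minor_sum m M - minor_sum_diff m M (H *m M)).
Proof.
rewrite minor_sum_diff_col; congr (_ * _); rewrite sum_ffun_cons.
rewrite /minor_sum /minor_sum_diff mulr_sumr -sumrB; apply: eq_bigr => j _.
have E p : (\adj (mxsub (ffun_cons (p, j)) (ffun_cons (p, j)) M) *m
    mxsub (ffun_cons (p, j)) (ffun_cons (p, j)) H) 0 0 =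
  H p p * \det (mxsub j j M) -
  ((\row_b M p (j b)) *m \adj (mxsub j j M) *m (\col_a H (j a) p)) 0 0.
  rewrite tr_adj_mul -[X in X * _](mxE matrix_key (fun _ _ : 'I_1 => H p p) 0 0).
  rewrite -det_bordered; congr (\det _); apply/matrixP => a b.
  have conl x : ffun_cons (p, j) (lshift m (x : 'I_1)) = p.
    by rewrite ffunE (unsplitK (inl _ _)).
  have conr x : ffun_cons (p, j) (@rshift 1 m x) = j x.
    by rewrite ffunE (unsplitK (inr _ _)).
  have r0 x : (@rshift 1 m x == 0) = false by [].
  have l0 (x : 'I_1) : (lshift m x == 0) by rewrite ord1.
  case: (@split_ordP 1 m a) => a' ->; case: (@split_ordP 1 m b) => b' ->.
  - by rewrite [RHS](@block_mxEul _ 1 m 1 m) !mxE l0 !conl.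
  - by rewrite [RHS](@block_mxEur _ 1 m 1 m) !mxE r0 conl conr.
  - by rewrite [RHS](@block_mxEdl _ 1 m 1 m) !mxE l0 conl conr.
  - by rewrite [RHS](@block_mxEdr _ 1 m 1 m) !mxE r0 !conr.
rewrite (eq_bigr _ (fun p _ => E p)) sumrB -mulr_suml; congr (_ - _).
transitivity (\sum_p \sum_a \sum_b
    M p (j b) * (\adj (mxsub j j M) b a * H (j a) p)).
  apply: eq_bigr => p _; rewrite mxE; apply: eq_bigr => a _.
  rewrite [(\col_a0 _) _ _]mxE mxE mulr_suml; apply: eq_bigr => b _.
  by rewrite [(\row_b0 _) _ _]mxE mulrA.
rewrite exchange_big /=; under eq_bigr do rewrite exchange_big /=.
rewrite exchange_big; apply: eq_bigr => b _ /=.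
rewrite mxE; apply: eq_bigr => a _; rewrite !mxE mulr_sumr.
by apply: eq_bigr => p _; rewrite mulrCA [_ * H _ _]mulrC.
Qed.

Lemma newton_mx_commute m M Z : M *m Z = Z *m M ->
  newton_mx m M *m Z = Z *m newton_mx m M.
Proof.
move=> MZ; elim: m => [|m IHm] /=; first by rewrite mulmx1 mul1mx.
rewrite mulmxBr mulmxBl scalar_mxC; congr (_ - _).
by rewrite -scalemxAr -scalemxAl -mulmxA IHm mulmxA MZ mulmxA.
Qed.

Lemma newton_mx_comm m M : M *m newton_mx m M = newton_mx m M *m M.
Proof. by rewrite newton_mx_commute. Qed.

Lemma minor_sum0 M : minor_sum 0 M = 1.
Proof.
rewrite /minor_sum (eq_bigr (fun=> 1)) => [|j _]; last exact: det_mx00.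
by rewrite sumr_const card_ffun !card_ord expn0.
Qed.

(** Moving M around the trace turns the recursion [minor_sum_diffS] into the one
that defines the Newton transform; the value of [minor_sum m.+1] that it needs
comes from the case H = M by homogeneity. *)
Lemma minor_sum_diff_newton m M H :
  minor_sum_diff m.+1 M H = m.+1%:R * \tr (newton_mx m M *m H).
Proof.
have diff0 H' : minor_sum_diff 0 M H' = 0.
  rewrite /minor_sum_diff big1 // => j _.
  by rewrite /mxtrace big_ord0.
elim: m H => [|m IHm] H; rewrite minor_sum_diffS.
  by rewrite diff0 minor_sum0 subr0 mulr1 mul1mx.
have -> : minor_sum m.+1 M = \tr (newton_mx m M *m M).
  have m0 : m.+1%:R != 0 :> F by rewrite pnatr_eq0.
  by apply: (mulfI m0); rewrite -minor_sum_diff_self IHm.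
congr (_ * _); rewrite IHm /= mulmxBl mul_scalar_mx raddfB /= mxtraceZ.
rewrite mulrC -scalemxAl mxtraceZ; congr (_ * _ - _ * _).
by rewrite mulmxA mxtrace_mulC mulmxA.
Qed.

Lemma minor_sumS m M : minor_sum m.+1 M = \tr (newton_mx m M *m M).
Proof.
have m0 : m.+1%:R != 0 :> F by rewrite pnatr_eq0.
by apply: (mulfI m0); rewrite -minor_sum_diff_self minor_sum_diff_newton.
Qed.

End MinorSums.

(** * Newton transforms: symmetries and diagonal matrices *)

Section NewtonTheory.
Variables (F : numDomainType) (N : nat).
Implicit Types (M : 'M[F]_N) (l : 'rV[F]_N).

Lemma newton_mx_tr m M : (newton_mx m M)^T = newton_mx m M^T.
Proof.
elim: m => [|m IHm] /=; first by rewrite tr_scalar_mx.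
rewrite linearB linearZ /= tr_scalar_mx trmx_mul IHm.
rewrite [in RHS]newton_mx_comm; congr (_%:M - _).
by rewrite -IHm -trmx_mul mxtrace_tr mxtrace_mulC.
Qed.

Lemma newton_mx_conj m M (Q Q' : 'M[F]_N) : Q *m Q' = 1%:M ->
  newton_mx m (Q *m M *m Q') = Q *m newton_mx m M *m Q'.
Proof.
move=> QQ'; have Q'Q := mulmx1C QQ'.
elim: m => [|m IHm] /=; first by rewrite mulmx1 QQ'.
have conjM A B : Q *m A *m Q' *m (Q *m B *m Q') = Q *m (A *m B) *m Q'.
  by rewrite !mulmxA -[_ *m Q' *m Q]mulmxA Q'Q mulmx1.
rewrite IHm !conjM mulmxBr mulmxBl -scalemxAr -scalemxAl; congr (_ - _).
rewrite mxtrace_mulC (mulmxA Q') Q'Q mul1mx scalar_mxC -mulmxA QQ' mulmx1.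
by [].
Qed.

(** Generating polynomial of the elementary symmetric functions of the entries
of l whose index satisfies P. *)
Definition elem_gen (P : pred 'I_N) l : {poly F} :=
  \prod_(j < N | P j) (1 + l 0 j *: 'X).

(** Eigenvalue of [newton_mx m] on the p-th eigenvector: m! times the m-th
elementary symmetric function of the other eigenvalues. *)
Definition newton_eig m l (p : 'I_N) : F :=
  m`!%:R * (elem_gen (predC1 p) l)`_m.

Lemma elem_gen_mul l p :
  elem_gen xpredT l = (1 + l 0 p *: 'X) * elem_gen (predC1 p) l.
Proof. by rewrite /elem_gen (bigD1 p). Qed.

Lemma deriv_elem_gen l :
  (elem_gen xpredT l)^`() = \sum_p l 0 p *: elem_gen (predC1 p) l.
Proof.
rewrite /elem_gen deriv_prod ?index_enum_uniq //; apply: eq_bigr => p _.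
rewrite (bigD1 p) //= eqxx derivD derivC derivZ derivX add0r -mul_polyC mulr1.
rewrite -mul_polyC; congr (_ * _); apply: eq_bigr => j.
by case: eqVneq.
Qed.

(** The recursion of the Newton transform is checked on coefficients: splitting
off the factor p of the full product relates the eigenvalue p to the trace, and
the trace is a coefficient of the derivative of that product. *)
Lemma newton_mx_diag m l :
  newton_mx m (diag_mx l) = diag_mx (\row_p newton_eig m l p).
Proof.
elim: m => [|m IHm].
  apply/matrixP=> p q; rewrite !mxE /newton_eig fact0 mul1r.
  rewrite -horner_coef0 horner_prod big1 ?mulr1n // => j _.
  by rewrite hornerD hornerZ hornerX mulr0 addr0 hornerC.
rewrite /= IHm mulmx_diag mxtrace_diag mulmx_diag.
have -> : \sum_i (\row_j ((\row_p newton_eig m l p) 0 j * l 0 j)) 0 i =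
    m.+1`!%:R * (elem_gen xpredT l)`_m.+1.
  have := congr1 (fun p : {poly F} => p`_m) (deriv_elem_gen l).
  rewrite coef_deriv coef_sum factS mulnC natrM -mulrA -[_ *+ m.+1]mulr_natl => ->.
  rewrite mulr_sumr; apply: eq_bigr => p _; rewrite !mxE /newton_eig coefZ.
  by rewrite -mulrA [l 0 p * _]mulrC.
apply/matrixP=> p q; rewrite !mxE.
case: eqVneq => _; last first.
  by rewrite !mulr0n mulr0 subr0.
rewrite !mulr1n /newton_eig (elem_gen_mul l p) mulrDl mul1r coefD.
rewrite -scalerAl coefZ coefXM /= factS mulnC natrM; ring.
Qed.

Lemma coef_linear_mul (a : F) (p : {poly F}) m :
  ((1 + a *: 'X) * p)`_m = p`_m + (if m is m'.+1 then a * p`_m' else 0).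
Proof.
by rewrite mulrDl mul1r coefD -scalerAl coefZ coefXM; case: m; rewrite ?mulr0.
Qed.

Lemma coef_prod_linear_ge0 (s : seq 'I_N) l m : (forall j, 0 <= l 0 j) ->
  0 <= (\prod_(j <- s) (1 + l 0 j *: 'X))`_m.
Proof.
move=> l0; elim: s m => [|a s IHs] m.
  by rewrite big_nil coef1 ler0n.
rewrite big_cons coef_linear_mul addr_ge0 //.
by case: m => // m; rewrite mulr_ge0.
Qed.

(** The coefficient of degree m is a sum of products of m entries, all
nonnegative, and one of them has no zero factor. *)
Lemma coef_prod_linear_gt0 (s : seq 'I_N) l m : (forall j, 0 <= l 0 j) ->
  (m <= count (fun j => l 0%R j != 0%R) s)%N ->
  0 < (\prod_(j <- s) (1 + l 0 j *: 'X))`_m.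
Proof.
move=> l0; elim: s m => [|a s IHs] m /=.
  by rewrite leqn0 => /eqP->; rewrite big_nil coef1.
rewrite big_cons coef_linear_mul; case: (eqVneq (l 0 a) 0) => [->|a0] /=.
  move=> /IHs; case: m => [|m]; rewrite ?addr0 // mul0r addr0 //.
case: m => [|m] ms; first by rewrite addr0 IHs.
rewrite ltr_wpDl ?coef_prod_linear_ge0 // mulr_gt0 ?IHs //.
by rewrite lt_def a0 l0.
Qed.

Lemma newton_eig_ge0 m l p : (forall j, 0 <= l 0 j) -> 0 <= newton_eig m l p.
Proof.
move=> l0; rewrite mulr_ge0 ?ler0n // /elem_gen -big_filter.
exact: coef_prod_linear_ge0.
Qed.

(** With m+1 nonzero entries, p could be chosen among them, and the other m
would make the elementary symmetric function without p positive. *)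
Lemma card_support_newton_eig m l : (forall j, 0 <= l 0 j) ->
  (forall p, l 0 p * newton_eig m l p = 0) ->
  (#|[set p | l 0%R p != 0%R]%SET| <= m)%N.
Proof.
move=> l0 lt0; rewrite leqNgt; apply/negP => mK.
have [p pK] : exists p, p \in [set p | l 0%R p != 0%R]%SET.
  by apply/card_gt0P; apply: leq_ltn_trans mK.
have := lt0 p; move/eqP; rewrite inE in pK; rewrite mulf_eq0 (negPf pK) /=.
rewrite /newton_eig mulf_eq0 pnatr_eq0 eqn0Ngt fact_gt0 /= /elem_gen -big_filter gt_eqF //.
apply: coef_prod_linear_gt0 => //.
move: mK; rewrite (cardsD1 p) inE pK add1n ltnS => /leq_trans; apply.
rewrite -sum1_count big_filter_cond -sum1_card; apply: eq_leq.
by apply: eq_bigl => j; rewrite !inE.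
Qed.

End NewtonTheory.

(** * Almost diagonal matrices *)

Section NearDiagonal.
Variables (F : realDomainType) (N : nat).
Implicit Types (A B L : 'M[F]_N) (C K e : F).

(** Entries bounded by C, with the extra small factor e off the diagonal.  The
order of magnitude e survives sums and products, at the cost of a larger C,
because each term of an off-diagonal entry of a product has an off-diagonal
factor. *)
Definition near_diag C e A : Prop :=
  forall p q, `|A p q| <= C /\ (p != q -> `|A p q| <= C * e).

Lemma near_diag_scalar C e a : 0 <= C -> 0 <= e -> `|a| <= C ->
  near_diag C e a%:M.
Proof.
move=> C0 e0 aC p q; rewrite mxE; case: eqVneq => _; rewrite ?mulr1n //; split=> [|_].
  by rewrite normr0.
by rewrite normr0 mulr_ge0.
Qed.

Lemma near_diagB C C' e A B : near_diag C e A -> near_diag C' e B ->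
  near_diag (C + C') e (A - B).
Proof.
move=> hA hB p q; rewrite !mxE; have [A1 A2] := hA p q; have [B1 B2] := hB p q.
split=> [|pq]; apply: le_trans (ler_normB _ _) _; first exact: lerD.
by rewrite mulrDl lerD ?A2 ?B2.
Qed.

Lemma near_diagZ a C e A : near_diag C e A -> near_diag (`|a| * C) e (a *: A).
Proof.
move=> hA p q; rewrite !mxE normrM; have [A1 A2] := hA p q.
split=> [|pq]; first by rewrite ler_wpM2l.
by rewrite -mulrA ler_wpM2l ?A2.
Qed.

Lemma near_diagM C C' e A B : 0 <= C -> 0 <= C' -> 0 <= e ->
  near_diag C e A -> near_diag C' e B ->
  near_diag (N%:R * (C * C')) e (A *m B).
Proof.
move=> C0 C'0 e0 hA hB p q; rewrite mxE.
have bnd (c : F) : (forall r, `|A p r * B r q| <= c) ->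
    `|\sum_r A p r * B r q| <= N%:R * c.
  move=> h; apply: le_trans (ler_norm_sum _ _ _) _.
  apply: le_trans (ler_sum _ (fun r _ => h r)) _.
  by rewrite sumr_const card_ord mulr_natl.
split=> [|pq]; first by apply: bnd => r; rewrite normrM ler_pM ?(hA p r).1 ?(hB r q).1.
rewrite -mulrA; apply: bnd => r; rewrite normrM.
case: (eqVneq p r) => [<-|pr].
  by rewrite -mulrA ler_pM ?(hA p p).1 ?(hB p q).2.
by rewrite -mulrA [C' * e]mulrC mulrA ler_pM ?(hA p r).2 ?(hB r q).1.
Qed.

(** The constant depends only on K and m: this is the Lipschitz estimate that
makes the off-diagonal part of the flow satisfy a linear inequality. *)
Lemma near_diag_newton K m : 0 <= K -> exists2 C, 0 <= C &
  forall L e, 0 <= e -> near_diag K e L -> near_diag C e (newton_mx m L).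
Proof.
move=> K0; elim: m => [|m [C C0 IHm]].
  by exists 1 => // L e e0 _; apply: near_diag_scalar; rewrite ?normr1.
pose C1 := N%:R * (K * C).
have C10 : 0 <= C1 by rewrite !mulr_ge0.
exists (N%:R * C1 + m.+1%:R * C1) => [|L e e0 hL].
  by rewrite addr_ge0 ?mulr_ge0.
have hLU : near_diag C1 e (L *m newton_mx m L).
  by apply: near_diagM => //; exact: IHm.
rewrite /=; apply: near_diagB; last first.
  by have := near_diagZ m.+1%:R hLU; rewrite ger0_norm.
apply: near_diag_scalar; rewrite ?mulr_ge0 //.
rewrite -newton_mx_comm /mxtrace; apply: le_trans (ler_norm_sum _ _ _) _.
apply: le_trans (ler_sum _ (fun r _ => (hLU r r).1)) _.
by rewrite sumr_const card_ord mulr_natl.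
Qed.

End NearDiagonal.

(** * The real spectral theorem *)

Section RealSpectral.
Variable R : rcfType.

Lemma sum_sqr_eq0 n (v : 'rV[R]_n) : (v *m v^T) 0 0 = 0 -> v = 0.
Proof.
rewrite mxE; under eq_bigr do rewrite mxE -expr2.
move=> /eqP; rewrite psumr_eq0; last by move=> *; exact: sqr_ge0.
move=> /allP v0; apply/rowP=> i; rewrite mxE; apply/eqP.
by rewrite -sqrf_eq0; apply: v0; rewrite mem_index_enum.
Qed.

(** A complex eigenvector x + i y exists.  Symmetry of M equates x M y^T and
y M x^T, which forces the imaginary part of the eigenvalue to vanish; then x or
y is a real eigenvector. *)
Lemma sym_eigenvector n (M : 'M[R]_n.+1) : M^T = M ->
  exists (r : R) (v : 'rV[R]_n.+1), v *m M = r *: v /\ v *m v^T = 1%:M.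
Proof.
move=> Msym.
pose f : {rmorphism R -> R[i]} := real_complex R.
have [a /eigenvalueP[w wM w0]] := @spectral.eigenvalue_closed R[i] _ (map_mx f M) isT.
pose x := map_mx (@complex.Re R) w; pose y := map_mx (@complex.Im R) w.
have Re_sum (F : 'I_n.+1 -> R[i]) :
    complex.Re (\sum_i F i) = \sum_i complex.Re (F i).
  by apply: (big_morph (@complex.Re R)) => // -[? ?] [? ?].
have Im_sum (F : 'I_n.+1 -> R[i]) :
    complex.Im (\sum_i F i) = \sum_i complex.Im (F i).
  by apply: (big_morph (@complex.Im R)) => // -[? ?] [? ?].
(* Real and imaginary parts of w M = a w. *)
have Mx : x *m M = complex.Re a *: x - complex.Im a *: y.
  apply/rowP=> k; move/rowP: wM => /(_ k) /(congr1 (@complex.Re R)).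
  rewrite !mxE Re_sum; case: a => b c; case: (w 0 k) => wr wi /= <-.
  apply: eq_bigr => i _; rewrite !mxE; case: (w 0 i) => ? ? /=.
  by rewrite mulr0 subr0.
have My : y *m M = complex.Im a *: x + complex.Re a *: y.
  apply/rowP=> k; clear Mx; move/rowP: wM => /(_ k) /(congr1 (@complex.Im R)).
  rewrite !mxE Im_sum; case: a => b c; case: (w 0 k) => wr wi /=.
  rewrite addrC => <-.
  apply: eq_bigr => i _; rewrite !mxE; case: (w 0 i) => ? ? /=.
  by rewrite mulr0 add0r.
have sqr_ge (u : 'rV[R]_n.+1) : 0 <= (u *m u^T) 0 0.
  by rewrite mxE sumr_ge0 // => i _; rewrite mxE -expr2 sqr_ge0.
have w_eq0 : x = 0 -> y = 0 -> w = 0.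
  move=> /rowP x0 /rowP y0; apply/rowP=> k; move: (x0 k) (y0 k); rewrite !mxE.
  by case: (w 0 k) => b c /= -> ->.
have a0 : complex.Im a = 0.
  have xMy : x *m M *m y^T = (y *m M *m x^T)^T.
    by rewrite !trmx_mul trmxK Msym mulmxA.
  have xy : x *m y^T = (y *m x^T)^T by rewrite trmx_mul trmxK.
  have /eqP : complex.Im a * ((x *m x^T) 0 0 + (y *m y^T) 0 0) = 0.
    move: xMy; rewrite Mx My mulmxBl mulmxDl -!scalemxAl xy.
    have lin (A B C : 'M[R]_1) b c : b *: A^T - c *: B = (c *: C + b *: A)^T ->
        c * (C 0 0 + B 0 0) = 0.
      by move=> /matrixP/(_ 0 0); rewrite !mxE; lra.
    exact: lin.
  rewrite mulf_eq0 => /orP[/eqP //|]; rewrite paddr_eq0 // => /andP[/eqP x0 /eqP y0].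
  by move/eqP: w0; case; rewrite w_eq0 //; apply: sum_sqr_eq0.
rewrite a0 scale0r subr0 in Mx; rewrite a0 scale0r add0r in My.
have [u uM u0] : exists2 u : 'rV_n.+1, u *m M = complex.Re a *: u & u != 0.
  have [x0|] := eqVneq x 0; last by exists x.
  by exists y => //; apply: contra_neq w0 => y0; exact: w_eq0.
pose c := (u *m u^T) 0 0.
have c0 : 0 < c.
  by rewrite lt_def sqr_ge andbT; apply: contra_neq u0 => /sum_sqr_eq0.
exists (complex.Re a), ((Num.sqrt c)^-1 *: u); split.
  by rewrite -scalemxAl uM !scalerA mulrC.
rewrite [X in _ *m X]linearZ /= -scalemxAl -scalemxAr scalerA.
apply/matrixP=> i j; rewrite !ord1 mxE -/c mxE eqxx -invfM -expr2 sqr_sqrtr ?ltW //.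
by rewrite mulVf // gt_eqF.
Qed.

(** The reflection exchanging v and the first basis vector. *)
Lemma householder n (v : 'rV[R]_(1 + n)) : v *m v^T = 1%:M ->
  exists2 H : 'M[R]_(1 + n), H *m H^T = 1%:M & row 0 H = v.
Proof.
move=> vv; pose e : 'rV[R]_(1 + n) := delta_mx 0 0.
have [<-|ve] := eqVneq e v.
  by exists 1%:M; rewrite ?trmx1 ?mulmx1 // rowE mulmx1.
have [w wE] : exists w, w = v - e by exists (v - e).
pose s : R := (w *m w^T) 0 0.
have ww : w *m w^T = s%:M by rewrite [LHS]mx11_scalar.
have s0 : s != 0.
  by apply: contra_neq ve => /sum_sqr_eq0 /eqP; rewrite wE subr_eq0 => /eqP.
have ue (u : 'rV[R]_(1 + n)) : u *m e^T = (u 0 0)%:M.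
  rewrite trmx_delta -colE; apply/matrixP=> i j.
  by rewrite !ord1 !mxE eqxx mulr1n.
have eu (u : 'rV[R]_(1 + n)) : e *m u^T = (u 0 0)%:M.
  by rewrite -[LHS]trmxK trmx_mul trmxK ue tr_scalar_mx.
have ev : e *m w^T = (v 0 0 - 1)%:M by rewrite eu wE !mxE eqxx.
have sE : s = 2 * (1 - v 0 0).
  rewrite /s {1}wE mulmxBl ev wE linearB mulmxBr /= vv ue !mxE !mulr1n.
  ring.
exists (1%:M - (2 / s) *: (w^T *m w)).
  have -> : (1%:M - (2 / s) *: (w^T *m w))^T = 1%:M - (2 / s) *: (w^T *m w).
    by rewrite linearB linearZ /= tr_scalar_mx trmx_mul trmxK.
  rewrite mulmxBl mul1mx mulmxBr mulmx1.
  rewrite -scalemxAl -!scalemxAr mulmxA -[w^T *m w *m w^T]mulmxA ww.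
  rewrite mul_mx_scalar -scalemxAl !scalerA -addrA -opprD -[RHS]subr0.
  rewrite -scalerBl -scalerDl.
  rewrite [X in X *: _](_ : _ = 0) ?scale0r //.
  by field.
rewrite rowE -/e mulmxBr mulmx1 -scalemxAr mulmxA ev mul_scalar_mx scalerA.
have -> : 2 / s * (v 0 0 - 1) = -1.
  by apply: (mulIf s0); rewrite mulrAC divfK // sE; ring.
by rewrite scaleNr scale1r opprK wE addrC subrK.
Qed.

(** A reflection moves a unit eigenvector to the first basis vector; by symmetry
the matrix splits off a block of size 1. *)
Theorem real_spectral n (M : 'M[R]_n) : M^T = M ->
  exists2 Q : 'M[R]_n, Q *m Q^T = 1%:M & is_diag_mx (Q *m M *m Q^T).
Proof.
elim: n M => [|n IHn] M Msym.
  by exists 1%:M; [rewrite mul1mx trmx1 | apply/is_diag_mxP => -[]].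
have [r [v [vM vv]]] := sym_eigenvector Msym.
have [H HH Hv] := householder (n := n) vv.
pose A : 'M[R]_(1 + n) := H *m M *m H^T.
have Asym : A^T = A by rewrite /A !trmx_mul trmxK Msym mulmxA.
have A0 j : A 0 j = r *+ (0 == j).
  have -> : A 0 j = (row 0 A) 0 j by rewrite [RHS]mxE.
  rewrite /A !row_mul Hv vM -scalemxAl -Hv -row_mul HH.
  by rewrite !mxE mulr_natr.
have l0 : lshift n (0 : 'I_1) = 0 by apply: val_inj.
have Ablock : A = block_mx r%:M 0 0 (drsubmx A).
  rewrite -[LHS]submxK; congr block_mx.
  - apply/matrixP=> i j; rewrite !ord1 [LHS]mxE [LHS]mxE l0 A0.
    by rewrite !mxE.
  - by apply/matrixP=> i j; rewrite ord1 [LHS]mxE [LHS]mxE l0 A0 !mxE.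
  - apply/matrixP=> i j; rewrite ord1 [LHS]mxE [LHS]mxE l0 -Asym.
    by rewrite [LHS]mxE A0 !mxE.
have [|Q QQ Qd] := IHn (drsubmx A); first by rewrite trmx_drsub Asym.
pose Q1 : 'M[R]_(1 + n) := block_mx 1%:M 0 0 Q.
have Q1T : Q1^T = block_mx 1%:M 0 0 Q^T.
  by rewrite tr_block_mx trmx1 !trmx0.
exists (Q1 *m H).
  rewrite trmx_mul mulmxA -[Q1 *m H *m _]mulmxA HH mulmx1 Q1T (@mulmx_block _ 1 n 1 n 1 n).
  by rewrite !mulmx0 !mul0mx !addr0 add0r mulmx1 QQ -(@scalar_mx_block _ 1 n).
have -> : Q1 *m H *m M *m (Q1 *m H)^T = Q1 *m A *m Q1^T.
  by rewrite trmx_mul /A !mulmxA.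
rewrite Ablock Q1T /Q1 !(@mulmx_block _ 1 n 1 n 1 n).
rewrite !(mulmx0, mul0mx, addr0, add0r, mulmx1, mul1mx).
by rewrite (@is_diag_block_mx _ 1 n 1 n) // !eqxx Qd scalar_mx_is_diag.
Qed.
End RealSpectral.

(** * The Cayley-Menger formula *)

Lemma det_orthogonal_conj (F : comNzRingType) m (Q G : 'M[F]_m) :
  Q *m Q^T = 1%:M -> \det (Q *m G *m Q^T) = \det G.
Proof.
move=> QQ; rewrite !det_mulmx mulrAC -det_mulmx QQ det1 mul1r.
by [].
Qed.

Lemma gram_diag_ge0 (F : realDomainType) m k (Z : 'M[F]_(m, k)) i :
  0 <= (Z *m Z^T) i i.
Proof. by rewrite mxE sumr_ge0 // => j _; rewrite mxE -expr2 sqr_ge0. Qed.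

Lemma det_gram_ge0 (R : rcfType) m k (Z : 'M[R]_(m, k)) :
  0 <= \det (Z *m Z^T).
Proof.
have [|Q QQ Qd] := @real_spectral R _ (Z *m Z^T).
  by rewrite trmx_mul trmxK.
rewrite -(det_orthogonal_conj _ QQ) det_trig; last exact: is_diag_mx_is_trig.
rewrite prodr_ge0 // => i _.
have -> : Q *m (Z *m Z^T) *m Q^T = (Q *m Z) *m (Q *m Z)^T.
  by rewrite trmx_mul !mulmxA.
exact: gram_diag_ge0.
Qed.

Lemma det_add_rank1 (F : idomainType) m (G : 'M[F]_m) (c : 'cV[F]_m)
    (r : 'rV[F]_m) :
  \det (G + c *m r) = \det G + (r *m \adj G *m c) 0 0.
Proof.
have := det_bordered 1%:M (- r) c G; rewrite mxE eqxx mul1r !mulNmx.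
rewrite [X in _ - X]mxE opprK => <-.
have L1 : \det (block_mx (1%:M : 'M[F]_1) 0 (- c) 1%:M) = 1.
  by rewrite (@det_lblock _ 1) !det1 mulr1.
rewrite -[RHS]mul1r -[X in _ = X * _]L1 -det_mulmx (@mulmx_block _ 1 m 1 m 1 m).
rewrite !(mulmx0, mul0mx, addr0, add0r, mulmx1, mul1mx) addNr.
by rewrite (@det_ublock _ 1) det1 mul1r mulNmx mulmxN opprK addrC.
Qed.

(** The determinant of the Gram matrix of (Z, sqrt(s) u^T) is affine in s, with
this number as slope, and stays nonnegative for all s >= 0. *)
Lemma adj_gram_ge0 (R : rcfType) m k (Z : 'M[R]_(m, k)) (u : 'rV[R]_m) :
  0 <= (u *m \adj (Z *m Z^T) *m u^T) 0 0.
Proof.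
set b : R := (X in 0 <= X); set a : R := \det (Z *m Z^T).
have a0 : 0 <= a by exact: det_gram_ge0.
have ab s : 0 <= s -> 0 <= a + s * b.
  move=> s0.
  have := det_gram_ge0 (row_mx Z (Num.sqrt s *: u^T)).
  have -> : row_mx Z (Num.sqrt s *: u^T) *m (row_mx Z (Num.sqrt s *: u^T))^T =
      Z *m Z^T + u^T *m (s *: u).
    rewrite tr_row_mx mul_row_col; congr (_ + _).
    have -> : (Num.sqrt s *: u^T)^T = Num.sqrt s *: u.
      by apply/matrixP=> i j; rewrite !mxE.
    by rewrite -scalemxAl -!scalemxAr scalerA -expr2 sqr_sqrtr.
  by rewrite det_add_rank1 -!scalemxAl [in X in X -> _]mxE.
rewrite leNgt; apply/negP => b0.
have /ab : 0 <= (a + 1) / - b.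
  by apply: divr_ge0; [rewrite addr_ge0 | rewrite oppr_ge0 ltW].
rewrite invrN mulrN mulNr divfK ?lt_eqF //; lra.
Qed.

Section CayleyMenger.
Variables (R : realType) (d : nat).

Definition point_mx m (y : 'I_m -> 'rV[R]_d) : 'M[R]_(m, d) :=
  \matrix_(i, k) y i 0 k.

Lemma sqdist_mx_shift n (y : 'I_n.+1 -> 'rV[R]_d) c :
  sqdist_mx (fun a => y a - c) = sqdist_mx y.
Proof.
by apply/matrixP=> i j; rewrite !mxE opprB addrA subrK.
Qed.

Lemma sqdist_mxE n (y : 'I_n.+1 -> 'rV[R]_d) :
  sqdist_mx y = (\col_i sqnorm2 (y i)) *m const_mx 1 +
    const_mx 1 *m (\row_i sqnorm2 (y i)) +
    (- 2) *: (point_mx y *m (point_mx y)^T).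
Proof.
apply/matrixP=> i j; rewrite !mxE !big_ord1 !mxE mulr1 mul1r mulr_sumr.
rewrite /sqnorm2 -!big_split /=; apply: eq_bigr => k _; rewrite !mxE; ring.
Qed.

(** Adding multiples of the border row and column removes the terms
|y_i|^2 + |y_j|^2 from the squared distances and leaves - 2 G. *)
Lemma det_cayley_menger n (y : 'I_n.+1 -> 'rV[R]_d) :
  let G := point_mx y *m (point_mx y)^T in
  let u : 'rV[R]_n.+1 := const_mx 1 in
  \det (cayley_menger_mx y) = - (- 2) ^+ n * (u *m \adj G *m u^T) 0 0.
Proof.
move=> G u; pose r : 'rV[R]_n.+1 := \row_i sqnorm2 (y i).
have <- : \det (block_mx 0 u u^T ((-2) *: G)) =
    - (-2) ^+ n * (u *m \adj G *m u^T) 0 0.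
  rewrite det_bordered mxE mul0r add0r adjZ /= -scalemxAr -scalemxAl.
  by rewrite [in LHS]mxE mulNr.
have -> : cayley_menger_mx y = block_mx 1%:M 0 r^T 1%:M *m
    block_mx 0 u u^T ((-2) *: G) *m block_mx 1%:M r 0 1%:M.
  rewrite !(@mulmx_block _ 1 n.+1 1 n.+1 1 n.+1).
  rewrite !(mulmx0, mul0mx, addr0, add0r, mulmx1, mul1mx) /cayley_menger_mx.
  rewrite trmx_const; congr block_mx.
  rewrite sqdist_mxE addrCA addrA; congr (_ *m _ + _ + _).
  by apply/matrixP=> i j; rewrite !mxE.
by rewrite !det_mulmx (@det_lblock _ 1) (@det_ublock _ 1) !det1 !mul1r !mulr1.
Qed.

(** The translation by c is free because only distances enter; it will be the
mean of the points.  Nonnegativity of the cofactor sum undoes the square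
root. *)
Lemma simplex_vol_sqr n (y : 'I_n.+1 -> 'rV[R]_d) c :
  let Z := point_mx (fun a => y a - c) in
  simplex_vol y ^+ 2 =
  (n`!%:R ^+ 2)^-1 * \tr (\adj (Z *m Z^T) *m const_mx 1).
Proof.
move=> Z; rewrite /simplex_vol /cayley_menger_mx -(sqdist_mx_shift y c).
rewrite -/(cayley_menger_mx _) det_cayley_menger -/Z.
set v := (X in _ * (_ * X)).
have v0 : 0 <= v by exact: adj_gram_ge0.
have -> : \tr (\adj (Z *m Z^T) *m const_mx 1) = v.
  have -> : const_mx 1 = (const_mx 1 : 'rV[R]_n.+1)^T *m const_mx 1 :> 'M[R]_n.+1.
    by apply/matrixP=> i j; rewrite !mxE big_ord1 !mxE mulr1.
  by rewrite mulmxA mxtrace_mulC mulmxA /mxtrace big_ord1.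
have -> : (-1) ^+ n.+1 / (2 ^+ n * n`!%:R ^+ 2) * (- (-2) ^+ n * v) =
    (n`!%:R ^+ 2)^-1 * v :> R.
  have -> : (- 2) ^+ n = (-1) ^+ n * 2 ^+ n :> R by rewrite -exprMn mulN1r.
  have n0 : n`!%:R != 0 :> R by rewrite pnatr_eq0 -lt0n fact_gt0.
  have s1 : (-1) ^+ n * (-1) ^+ n = 1 :> R by rewrite -expr2 sqrr_sign.
  rewrite -[RHS]mul1r -[X in _ = X * _]s1 exprS.
  have p0 : 2 ^+ n != 0 :> R by rewrite expf_neq0.
  move: p0; set e := (-1) ^+ n; set p := 2 ^+ n => p0.
  by field; rewrite n0.
by rewrite sqr_sqrtr // mulr_ge0 // invr_ge0 exprn_ge0.
Qed.

Variable N : nat.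

Definition centering_mx : 'M[R]_N := 1%:M - N%:R^-1 *: const_mx 1.

Definition centered_mx (X : 'I_N -> 'rV[R]_d) : 'M[R]_(N, d) :=
  centering_mx *m point_mx X.

Lemma tr_centering_mx : centering_mx^T = centering_mx.
Proof. by rewrite linearB linearZ /= tr_scalar_mx trmx_const. Qed.

Lemma const_mul_centering : (0 < N)%N ->
  (const_mx 1 : 'M[R]_N) *m centering_mx = 0.
Proof.
move=> N0; rewrite mulmxBr mulmx1 -scalemxAr; apply/matrixP=> i j.
rewrite !mxE (eq_bigr (fun=> 1)); last by move=> k _; rewrite !mxE mulr1.
by rewrite sumr_const card_ord mulVf ?subrr // pnatr_eq0 -lt0n.
Qed.

Lemma centering_idem : (0 < N)%N -> centering_mx *m centering_mx = centering_mx.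
Proof.
move=> N0; rewrite {1}/centering_mx mulmxBl mul1mx -scalemxAl.
by rewrite const_mul_centering // scaler0 subr0.
Qed.

Lemma centered_mxE (X : 'I_N -> 'rV[R]_d) i k :
  centered_mx X i k = (X i - N%:R^-1 *: \sum_j X j) 0 k.
Proof.
rewrite /centered_mx mulmxBl mul1mx -scalemxAl !mxE summxE; congr (_ - _ * _).
by apply: eq_bigr => j _; rewrite !mxE mul1r.
Qed.

(** The sum of cofactors over tuples is [minor_sum_diff n.+1] along the all-ones
matrix.  One step of [minor_sum_diffS] leaves only the trace term, since the
all-ones matrix annihilates the centered Gram matrix. *)
Lemma simplex_potentialE n kappa (X : 'I_N -> 'rV[R]_d) : (0 < N)%N ->
  simplex_potential n kappa X =
  kappa * N%:R / (2 * N%:R ^+ n * n`!%:R ^+ 2) *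
  minor_sum n (centered_mx X *m (centered_mx X)^T).
Proof.
move=> N0; set M := _ *m _.
pose c := N%:R^-1 *: \sum_j X j.
have -> : simplex_potential n kappa X = kappa / (2 * n.+1%:R * N%:R ^+ n) *
    ((n`!%:R ^+ 2)^-1 * minor_sum_diff n.+1 M (const_mx 1)).
  rewrite /simplex_potential /minor_sum_diff; congr (_ * _); rewrite mulr_sumr.
  apply: eq_bigr => j _; rewrite (simplex_vol_sqr _ c); congr (_ * \tr (\adj _ *m _)).
    apply/matrixP=> a b; rewrite !mxE; apply: eq_bigr => k _.
    have pE e : point_mx (fun a0 => X (j a0) - c) e k = centered_mx X (j e) k.
      by rewrite centered_mxE mxE.
    by rewrite [(point_mx _)^T _ _]mxE [(centered_mx _)^T _ _]mxE !pE.
  by apply/matrixP=> a b; rewrite !mxE.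
rewrite minor_sum_diffS.
have -> : (const_mx 1 : 'M[R]_N) *m M = 0.
  by rewrite mulmxA (mulmxA (const_mx 1)) const_mul_centering // !mul0mx.
have -> : minor_sum_diff n M 0 = 0.
  rewrite /minor_sum_diff big1 // => j _.
  have -> : mxsub j j (0 : 'M[R]_N) = 0 by apply/matrixP=> ? ?; rewrite !mxE.
  by rewrite mulmx0 mxtrace0.
have -> : \tr (const_mx 1 : 'M[R]_N) = N%:R.
  rewrite /mxtrace (eq_bigr (fun=> 1)); last by move=> k _; rewrite !mxE.
  by rewrite sumr_const card_ord.
have n0 : n`!%:R != 0 :> R by rewrite pnatr_eq0 -lt0n fact_gt0.
have n1 : n.+1%:R != 0 :> R by rewrite pnatr_eq0.
have N1 : N%:R != 0 :> R by rewrite pnatr_eq0 -lt0n.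
rewrite subr0; field.
by rewrite n0 expf_neq0 // -natr1 addrC in n1 *.
Qed.

End CayleyMenger.

(** * The gradient of the potential *)

Lemma deriv_minor_sum (F : numDomainType) N m (M : 'M[{poly F}]_N) (x : F) :
  (\sum_(j : {ffun 'I_m -> 'I_N}) \det (mxsub j j M))^`().[x] =
  minor_sum_diff m (map_mx (horner_eval x) M)
    (map_mx (horner_eval x) (map_mx (@deriv F) M)).
Proof.
pose ev : {rmorphism {poly F} -> F} := horner_eval x.
have evE p : p.[x] = ev p by [].
rewrite raddf_sum evE raddf_sum; apply: eq_bigr => j _.
transitivity (ev (\det (mxsub j j M))^`()); first by [].
rewrite deriv_det -trace_map_mx map_mxM map_mx_adj.
by congr (\tr (\adj _ *m _)); apply/matrixP=> a b; rewrite !mxE.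
Qed.

Lemma horner_minor_sum (F : numDomainType) N m (M : 'M[{poly F}]_N) (x : F) :
  (\sum_(j : {ffun 'I_m -> 'I_N}) \det (mxsub j j M)).[x] =
  minor_sum m (map_mx (horner_eval x) M).
Proof.
pose ev : {rmorphism {poly F} -> F} := horner_eval x.
have evE p : p.[x] = ev p by [].
rewrite evE raddf_sum; apply: eq_bigr => j _.
transitivity (ev (\det (mxsub j j M))); first by [].
rewrite -det_map_mx.
by congr (\det _); apply/matrixP=> a b; rewrite !mxE.
Qed.

Lemma derive_line (R : realType) (V : normedModType R) (f : V -> R) (p v : V)
    (d : R) :
  is_derive (0 : R) (1 : R) (fun h => f (h *: v + p)) d -> 'D_v f p = d.
Proof.
move=> [_ <-]; rewrite /derive; set g := fun h : R => f (h *: v + p).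
suff -> : (fun h : R => h^-1 *: ((f \o shift p) (h *: v) - f p)) =
    (fun h : R => h^-1 *: ((g \o shift 0) (h *: 1) - g 0)) by [].
by apply/funext => h; rewrite /g /= addr0 scale0r add0r [h *: 1]mulr1.
Qed.

Section Gradient.
Variables (R : realType) (d N : nat).
Implicit Types (X : 'I_N -> 'rV[R]_d).

Lemma point_mx_dfwith X i k h :
  point_mx (dfwith X i (h *: delta_mx 0 k + X i)) =
  point_mx X + h *: delta_mx i k.
Proof.
apply/matrixP=> a b; rewrite !mxE; case: (eqVneq a i) => [->|ai].
  by rewrite dfwithin !mxE eqxx /= addrC.
by rewrite dfwithout 1?eq_sym //= mulr0 addr0.
Qed.

(** Along a line the function is a polynomial in h, so that the derivative is
computed by formal derivation. *)
Lemma derive_minor_sum_gram m (A B : 'M[R]_(N, d)) :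
  is_derive (0 : R) (1 : R)
    (fun h => minor_sum m.+1 ((A + h *: B) *m (A + h *: B)^T))
    (2 * m.+1%:R * \tr (B^T *m newton_mx m (A *m A^T) *m A)).
Proof.
(* The moving point A + h B, with h turned into an indeterminate. *)
pose Ap : 'M[{poly R}]_(N, d) := map_mx polyC A + 'X *: map_mx polyC B.
pose q := \sum_(j : {ffun 'I_m.+1 -> 'I_N}) \det (mxsub j j (Ap *m Ap^T)).
have -> : (fun h => minor_sum m.+1 ((A + h *: B) *m (A + h *: B)^T)) = horner q.
  apply/funext => h; rewrite horner_minor_sum; congr minor_sum.
  apply/matrixP=> a b; rewrite !mxE /horner_eval horner_sum.
  apply: eq_bigr => k _; rewrite !mxE hornerM !hornerD !hornerM !hornerC hornerX.
  by [].
apply: is_derive_eq; rewrite deriv_minor_sum minor_sum_diff_newton.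
have -> : map_mx (horner_eval 0) (Ap *m Ap^T) = A *m A^T.
  apply/matrixP=> a b; rewrite !mxE /horner_eval horner_sum.
  apply: eq_bigr => k _; rewrite !mxE hornerM !hornerD !hornerM !hornerC hornerX.
  by rewrite !mul0r !addr0.
have -> : map_mx (horner_eval 0) (map_mx (@deriv R) (Ap *m Ap^T)) =
    B *m A^T + (B *m A^T)^T.
  apply/matrixP=> a b; rewrite !mxE /horner_eval raddf_sum horner_sum -big_split.
  apply: eq_bigr => k _; rewrite !mxE /= derivM !derivD !derivM !derivC derivX.
  rewrite !hornerE; ring.
set U := newton_mx m _.
have UT : U^T = U by rewrite /U newton_mx_tr trmx_mul trmxK.
rewrite mulmxDr mxtraceD -[X in _ + X]mxtrace_tr trmx_mul trmxK UT.
rewrite [X in _ + X]mxtrace_mulC -mulr2n -[\tr (B^T *m _ *m _)]mxtrace_tr.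
rewrite !trmx_mul trmxK UT [U *m (B *m _)]mulmxA mxtrace_mulC.
ring.
Qed.

(** The centering projection fixes A, hence commutes with its Gram matrix and
with every Newton transform of it. *)
Lemma centering_newton m X : (0 < N)%N ->
  let A := centered_mx X in let U := newton_mx m (A *m A^T) in
  @centering_mx R N *m U *m A = U *m A.
Proof.
move=> N0 A U.
have PA : @centering_mx R N *m A = A by rewrite mulmxA centering_idem.
have AP : A^T *m @centering_mx R N = A^T.
  by rewrite -[LHS]trmxK trmx_mul trmxK tr_centering_mx PA.
have MP : A *m A^T *m @centering_mx R N = @centering_mx R N *m (A *m A^T).
  by rewrite -[LHS]mulmxA AP [RHS]mulmxA PA.
by rewrite -(newton_mx_commute m MP) -[LHS]mulmxA PA.
Qed.

(** Twice n times the constant of [simplex_potentialE]. *)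
Definition flow_rate (kappa : R) n : R :=
  kappa * N%:R * n%:R / (N%:R ^+ n * n`!%:R ^+ 2).

Lemma gradient_simplex_potential m kappa X i : (0 < N)%N ->
  gradient_at (@simplex_potential R d N m.+1 kappa) i X =
  row i (flow_rate kappa m.+1 *:
    (newton_mx m (centered_mx X *m (centered_mx X)^T) *m centered_mx X)).
Proof.
move=> N0; apply/rowP=> k; rewrite [LHS]mxE; apply: derive_line.
set A := centered_mx X; set U := newton_mx m _.
pose B : 'M[R]_(N, d) := @centering_mx R N *m delta_mx i k.
pose K := kappa * N%:R / (2 * N%:R ^+ m.+1 * m.+1`!%:R ^+ 2).
have -> : (fun h => simplex_potential m.+1 kappa
      (dfwith X i (h *: delta_mx 0 k + X i))) =
    (fun h => K * minor_sum m.+1 ((A + h *: B) *m (A + h *: B)^T)).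
  apply/funext => h; rewrite simplex_potentialE // -/K /centered_mx.
  by rewrite point_mx_dfwith mulmxDr -scalemxAr.
have PU : @centering_mx R N *m U *m A = U *m A by exact: centering_newton.
have := derive_minor_sum_gram m A B; rewrite -/U => HD.
apply: (is_derive_eq (is_deriveZ K HD)).
have -> : B^T *m U *m A = delta_mx k i *m (U *m A).
  by rewrite trmx_mul tr_centering_mx trmx_delta -PU !mulmxA.
have -> : \tr (delta_mx k i *m (U *m A)) = (U *m A) i k.
  rewrite /mxtrace (bigD1 k) //= big1 => [|j jk].
    rewrite addr0 mxE (bigD1 i) //= big1 => [|j ji].
      by rewrite mxE !eqxx mul1r addr0.
    by rewrite mxE (negPf ji) andbF mul0r.
  by rewrite mxE big1 // => a _; rewrite mxE (negPf jk) mul0r.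
rewrite [RHS]mxE [RHS]mxE /flow_rate /K scalerAl.
have n0 : m.+1`!%:R != 0 :> R by rewrite pnatr_eq0 -lt0n fact_gt0.
have N1 : N%:R != 0 :> R by rewrite pnatr_eq0 -lt0n.
rewrite /GRing.scale /=; congr (_ * _); field.
by rewrite n0 expf_neq0.
Qed.

End Gradient.

(** * Calculus lemmas *)

Section Calculus.
Variable R : realType.
Implicit Types (f h : R -> R).

Lemma cvg_sumr (T : Type) (F : set_system T) n (f : 'I_n -> T -> R)
    (l : 'I_n -> R) : Filter F -> (forall i, f i x @[x --> F] --> l i) ->
  \sum_(i < n) f i x @[x --> F] --> \sum_(i < n) l i.
Proof. by move=> FF fl; apply: cvg_big => //; exact: add_continuous. Qed.

Lemma is_derive_sumr n (f : 'I_n -> R -> R) (df : 'I_n -> R) (t : R) :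
  (forall i, is_derive t (1 : R) (f i) (df i)) ->
  is_derive t (1 : R) (fun s => \sum_(i < n) f i s) (\sum_(i < n) df i).
Proof.
move=> fdf; have -> : (fun s => \sum_(i < n) f i s) = \sum_(i < n) f i.
  by apply/funext => s; rewrite fct_sumE.
exact: is_derive_sum.
Qed.

Lemma is_derive_mulr f h (df dh t : R) :
  is_derive t (1 : R) f df -> is_derive t (1 : R) h dh ->
  is_derive t (1 : R) (fun s => f s * h s) (f t * dh + h t * df).
Proof. by move=> fdf hdh; exact: is_deriveM. Qed.

(** h(t) exp(- c t) is nonincreasing. *)
Lemma gronwall_eq0 h (dh : R -> R) (c T : R) : 0 <= T ->
  {within `[0, T], continuous h} ->
  (forall t : R, t \in `]0, T[ -> is_derive t (1 : R) h (dh t)) ->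
  (forall t : R, t \in `]0, T[ -> dh t <= c * h t) ->
  h 0 = 0 -> 0 <= h T -> h T = 0.
Proof.
move=> T0 hcont hder dhle h0 hT0.
pose g t := h t * expR (- c * t).
have gder t : t \in `]0, T[ -> is_derive t (1 : R) g
    (h t * (expR (- c * t) * - c) + expR (- c * t) * dh t).
  move=> tT; apply: is_derive_mulr; first exact: hder.
  apply: (@is_derive1_comp R expR ( *%R (- c))).
  apply: (is_derive_eq (is_derive_mulr (is_derive_cst (- c) t 1) (is_derive_id t 1))).
  by rewrite mulr0 addr0 mulr1.
have gT : g T <= g 0.
  apply: (@ler0_derive1_le_cc R g 0 T) => //.
  - by move=> t /gder[].
  - move=> t tT; rewrite derive1E; have [_ ->] := gder t tT.
    rewrite mulrCA -mulrDr pmulr_rle0 ?expR_gt0 //.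
    by have := dhle t tT; lra.
  - move=> t; apply: cvgM; first exact: hcont.
    apply: continuous_subspaceT => {}t; apply: continuous_comp.
      exact: mulrl_continuous.
    exact: continuous_expR.
  - by rewrite in_itv /= T0 lexx.
  - by rewrite in_itv /= T0 lexx.
apply/eqP; rewrite eq_le hT0 andbT.
by move: gT; rewrite /g h0 mul0r pmulr_lle0 ?expR_gt0.
Qed.

(** Precomposing with max 0 extends f to a monotone function on the whole
line. *)
Lemma nonincreasing_pinfty_cvg f :
  (forall s t : R, 0 <= s -> s <= t -> f t <= f s) ->
  (forall t : R, 0 <= t -> 0 <= f t) ->
  cvg (f t @[t --> +oo]).
Proof.
move=> fdec f0; pose g t := - f (Num.max 0 t).
have gcvg : cvg (g t @[t --> +oo]).
  apply/cvg_ex; eexists; apply: nondecreasing_cvgr.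
    move=> s t st; rewrite lerN2 fdec //; first by rewrite le_max lexx.
    by rewrite ge_max le_max lexx /= le_max st orbT.
  by exists 0 => _ [t _ <-]; rewrite oppr_le0 f0 // le_max lexx.
have : cvg (- g t @[t --> +oo]) by exact: is_cvgN.
move=> /cvg_ex[l gl]; apply/cvg_ex; exists l; apply: cvg_trans gl.
apply: near_eq_cvg; near=> t; rewrite /g opprK max_r //.
Unshelve. all: by end_near. Qed.

Lemma pos_sqr_nonincreasing_cvg f :
  (forall t : R, 0 <= t -> 0 < f t) ->
  (forall s t : R, 0 <= s -> s <= t -> f t ^+ 2 <= f s ^+ 2) ->
  cvg (f t @[t --> +oo]).
Proof.
move=> f0 fdec; apply: nonincreasing_pinfty_cvg => [s t s0 st|t /f0/ltW //].
by rewrite -ler_sqr ?nnegrE ?fdec // ltW ?f0 // (le_trans s0).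
Qed.

(** Once f vanishes it stays zero.  If it never vanishes, it has a constant sign
by the intermediate value theorem, and its absolute value is monotone. *)
Lemma sqr_nonincreasing_cvg f : {within `[0, +oo[, continuous f} ->
  (forall s t : R, 0 <= s -> s <= t -> f t ^+ 2 <= f s ^+ 2) ->
  cvg (f t @[t --> +oo]).
Proof.
move=> fcont fdec.
have [[t0 t00 ft0]|fn0] := pselect (exists2 t0, 0 <= t0 & f t0 = 0).
  apply/cvg_ex; exists 0; apply: cvg_near_cst; near=> t; apply/eqP.
  rewrite -sqrf_eq0 eq_le sqr_ge0 andbT -[leRHS](expr0n R 2) -ft0 fdec //.
have neq0 t : 0 <= t -> f t != 0.
  by move=> t0; apply/eqP => ft; apply: fn0; exists t.
have ivt t : 0 <= t -> 0 < f 0 * f t.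
  move=> t0; rewrite ltNge; apply/negP => le0.
  have ct : {within `[0, t], continuous f}.
    by apply: continuous_subspaceW fcont; exact: subset_itvl.
  have [|c] := IVT t0 ct (v := 0).
    rewrite ge_min le_max; move: le0.
    case: (ltrgtP (f 0) 0) (neq0 0 (lexx _)) => // a _;
      case: (ltrgtP (f t) 0) (neq0 t t0) => // b _; rewrite leNgt.
      by rewrite nmulr_rgt0 // b.
    by rewrite mulr_gt0.
  by rewrite in_itv /= => /andP[c0 _] /eqP; rewrite (negPf (neq0 _ c0)).
have f00 := neq0 0 (lexx _).
case: (ltgtP (f 0) 0) f00 ivt => // f0 _ ivt; last first.
  by apply: pos_sqr_nonincreasing_cvg => // t /ivt; rewrite pmulr_rgt0.
have : cvg (- f t @[t --> +oo]).
  apply: pos_sqr_nonincreasing_cvg => [t /ivt|s t s0 st].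
    by rewrite nmulr_rgt0 // oppr_gt0.
  by rewrite !sqrrN fdec.
move=> /cvg_ex[l fl]; apply/cvg_ex; exists (- l).
have -> : f = \- (fun t => - f t) by apply/funext => t /=; rewrite opprK.
exact: cvgN fl.
Unshelve. all: by end_near. Qed.

(** By the mean value theorem f(t+1) - f(t) is a value of the derivative; it
tends both to 0 and to b. *)
Lemma derive_pinfty_lim0 f (df : R -> R) (a b : R) :
  (forall t : R, 0 < t -> is_derive t (1 : R) f (df t)) ->
  f t @[t --> +oo] --> a -> df t @[t --> +oo] --> b -> b = 0.
Proof.
move=> fder fa dfb.
have diff0 : (f (t + 1) - f t) @[t --> +oo] --> (0 : R).
  rewrite -(subrr a); apply: cvgB => //.
  by rewrite (cvg_shiftr 1 f a).
have diffb : (f (t + 1) - f t) @[t --> +oo] --> b.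
  apply/cvgrPdist_le => e e0.
  move/cvgrPdist_le : (dfb) => /(_ e e0)[M [_ Mdf]].
  near=> t.
  have t0 : 0 < t by near: t; exact: nbhs_pinfty_gt.
  have Mt : M < t by near: t; apply: nbhs_pinfty_gt; rewrite num_real.
  have tt : t < t + 1 by rewrite ltrDl.
  have der (s : R) : s \in `]t, t + 1[ -> is_derive s (1 : R) f (df s).
    by rewrite in_itv /= => /andP[ts _]; apply: fder; exact: lt_trans ts.
  have [|c] := MVT tt der.
    apply: derivable_within_continuous => s sI.
    have : is_derive s (1 : R) f (df s).
      apply: fder; move: sI; rewrite in_itv /= => /andP[ts _]. 
      exact: lt_le_trans ts.
    by case.
  rewrite in_itv /= => /andP[tc _] ->.
  by rewrite addrAC subrr add0r mulr1; apply: Mdf; exact: lt_trans tc.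
exact: cvg_unique diffb diff0.
Unshelve. all: by end_near. Qed.

Lemma cvg_newton_mx (T : Type) (F : set_system T) N (L : T -> 'M[R]_N)
    (L' : 'M[R]_N) m : Filter F ->
  (forall p q, L t p q @[t --> F] --> L' p q) ->
  forall p q, newton_mx m (L t) p q @[t --> F] --> newton_mx m L' p q.
Proof.
move=> FF LL'; elim: m => [|m IHm] p q; first exact: cvg_cst.
have UL r s : (newton_mx m (L t) *m L t) r s @[t --> F] -->
    (newton_mx m L' *m L') r s.
  under eq_cvg do rewrite mxE; rewrite mxE.
  by apply: cvg_sumr => k; apply: cvgM.
have entry (M : 'M[R]_N) : newton_mx m.+1 M p q =
    (\sum_r (newton_mx m M *m M) r r) *+ (p == q) -
    m.+1%:R * (newton_mx m M *m M) p q.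
  rewrite /= newton_mx_comm; move: (newton_mx m M *m M) => Z.
  by rewrite !mxE.
under eq_cvg do rewrite entry; rewrite entry.
apply: cvgB; last by apply: cvgM; [exact: cvg_cst | exact: UL].
by case: (p == q); [apply: cvg_sumr | exact: cvg_cst].
Qed.

End Calculus.

(** * The flow of Gram matrices *)

Section GramFlow.
Variables (R : realType) (N d m : nat) (g : R) (B : R -> 'M[R]_(N, d)).
Hypothesis g0 : 0 < g.
Hypothesis Bcont : forall p k,
  {within `[0, +oo[, continuous (fun t => B t p k)}.
Hypothesis Bder : forall (t : R) p k, 0 < t ->
  is_derive t (1 : R) (fun s => B s p k)
    (- g * (newton_mx m (B t *m (B t)^T) *m B t) p k).
Hypothesis B0 : is_diag_mx (B 0 *m (B 0)^T).

Let L t := B t *m (B t)^T.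

Let L_entry t p q : L t p q = \sum_k B t p k * B t q k.
Proof. by rewrite mxE; apply: eq_bigr => k _; rewrite mxE. Qed.

Let newton_L_sym t : (newton_mx m (L t))^T = newton_mx m (L t).
Proof. by rewrite newton_mx_tr trmx_mul trmxK. Qed.

Lemma gram_flow_continuous p q :
  {within `[0, +oo[, continuous (fun t => L t p q)}.
Proof.
have -> : (fun t => L t p q) = fun t => \sum_k B t p k * B t q k.
  by apply/funext => t; exact: L_entry.
by move=> t; apply: cvg_sumr => k; apply: cvgM; exact: Bcont.
Qed.

Lemma gram_flow_derive (t : R) p q : 0 < t ->
  is_derive t (1 : R) (fun s => L s p q)
    (- (2 * g) * (newton_mx m (L t) *m L t) p q).
Proof.
move=> t0.
have -> : (fun s => L s p q) = fun s => \sum_k B s p k * B s q k.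
  by apply/funext => s; exact: L_entry.
have := is_derive_sumr (fun k => is_derive_mulr (Bder p k t0) (Bder q k t0)).
move=> /is_derive_eq; apply; rewrite -/(L t).
set U := newton_mx m (L t).
have E : \sum_k (B t p k * (- g * (U *m B t) q k) +
     B t q k * (- g * (U *m B t) p k)) =
   - g * ((B t *m (U *m B t)^T) p q + (U *m B t *m (B t)^T) p q).
  rewrite [(B t *m _) p q]mxE [(U *m B t *m _) p q]mxE -big_split mulr_sumr /=.
  by apply: eq_bigr => k _; rewrite [_^T _ _]mxE [(B t)^T _ _]mxE; ring.
rewrite E trmx_mul newton_L_sym mulmxA -/(L t) newton_mx_comm -/U -mulmxA.
rewrite -/(L t).
ring.
Qed.

Lemma gram_flow_bounded (T : R) : 0 <= T -> exists2 K, 0 <= K &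
  forall t p q, t \in `[0, T] -> `|L t p q| <= K.
Proof.
move=> T0; pose s t := \sum_p \sum_q L t p q * L t p q.
have scont : {within `[0, T], continuous s}.
  apply: (@continuous_subspaceW _ _ `[0, T] `[0, +oo[); first exact: subset_itvl.
  move=> t; apply: cvg_sumr => p; apply: cvg_sumr => q.
  by apply: cvgM; exact: gram_flow_continuous.
have [c _ smax] := EVT_max T0 scont.
have s_ge t p q : L t p q ^+ 2 <= s t.
  rewrite /s (bigD1 p) //= (bigD1 q) //= -expr2 -addrA lerDl addr_ge0 //.
    by apply: sumr_ge0 => i _; rewrite -expr2 sqr_ge0.
  by apply: sumr_ge0 => i _; apply: sumr_ge0 => j _; rewrite -expr2 sqr_ge0.
have s0 : 0 <= s c.
  by apply: sumr_ge0 => i _; apply: sumr_ge0 => j _; rewrite -expr2 sqr_ge0.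
(* x^2 <= s implies |x| <= s + 1, which avoids a square root. *)
exists (s c + 1) => [|t p q tT]; first by rewrite addr_ge0.
have := le_trans (s_ge t p q) (smax t tT); rewrite -real_normK ?num_real //.
by move: (normr_ge0 (L t p q)); nra.
Qed.

Let offdiag t := \sum_p \sum_q (p != q)%:R * (L t p q * L t p q).

Let offdiag_ge0 t : 0 <= offdiag t.
Proof.
apply: sumr_ge0 => p _; apply: sumr_ge0 => q _.
by rewrite mulr_ge0 // -expr2 sqr_ge0.
Qed.

Let offdiag_ge t p q : p != q -> L t p q ^+ 2 <= offdiag t.
Proof.
move=> pq; rewrite /offdiag (bigD1 p) //= (bigD1 q) //= pq mul1r -expr2.
rewrite -addrA lerDl addr_ge0 //.
  by apply: sumr_ge0 => i _; rewrite mulr_ge0 // -expr2 sqr_ge0.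
apply: sumr_ge0 => i _; apply: sumr_ge0 => j _.
by rewrite mulr_ge0 // -expr2 sqr_ge0.
Qed.

(** With e the square root of [offdiag t], both L and T(L) L are nearly diagonal
of order e, so the product of two off-diagonal entries is of order e^2. *)
Lemma gram_flow_offdiag_bound (T : R) : 0 <= T -> exists2 C, 0 <= C &
  forall t p q, t \in `[0, T] -> p != q ->
    `|L t p q * (- (2 * g) * (newton_mx m (L t) *m L t) p q)| <= C * offdiag t.
Proof.
move=> T0; have [K K0 LK] := gram_flow_bounded T0.
have K10 : 0 <= K + 1 by rewrite addr_ge0.
have [C C0 UC] := near_diag_newton N m K10.
exists (2 * g * (N%:R * (C * (K + 1)))) => [|t p q tT pq].
  by rewrite !mulr_ge0 // ltW.
pose e := Num.sqrt (offdiag t).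
have e0 : 0 <= e by exact: sqrtr_ge0.
have ee : e * e = offdiag t by rewrite -expr2 sqr_sqrtr.
have Le r s : r != s -> `|L t r s| <= e.
  by move=> rs; rewrite -sqrtr_sqr ler_wsqrtr // offdiag_ge.
have LC : near_diag (K + 1) e (L t).
  move=> r s; split=> [|rs].
    by apply: le_trans (LK t r s tT) _; rewrite lerDl.
  by apply: le_trans (Le r s rs) _; rewrite mulrDl mul1r lerDr mulr_ge0.
have ULC := near_diagM C0 K10 e0 (UC _ _ e0 LC) LC.
rewrite normrM normrM normrN (ger0_norm (mulr_ge0 _ (ltW g0))) //.
rewrite -ee mulrCA -!mulrA ler_wpM2l // ler_wpM2l ?(ltW g0) //.
have [_ /(_ pq)] := ULC p q; have := Le p q pq.
move=> h1 h2; apply: le_trans (ler_pM _ _ h1 h2) _ => //.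
rewrite le_eqVlt; apply/orP; left; apply/eqP; ring.
Qed.

(** The function [offdiag] starts at 0 and its derivative is at most a constant
multiple of itself. *)
Lemma gram_flow_diagonal t : 0 <= t -> is_diag_mx (L t).
Proof.
move=> t0; suff h0 : offdiag t = 0.
  apply/is_diag_mxP => p q pq; apply/eqP; rewrite -sqrf_eq0 eq_le sqr_ge0 andbT.
  by rewrite -h0 offdiag_ge.
have [C C0 LC] := gram_flow_offdiag_bound t0.
pose dL s p q := - (2 * g) * (newton_mx m (L s) *m L s) p q.
pose dh s := \sum_p \sum_q (p != q)%:R * (L s p q * dL s p q + L s p q * dL s p q).
apply: (@gronwall_eq0 R offdiag dh (N%:R * (N%:R * (2 * C))) t) => //.
- apply: (@continuous_subspaceW _ _ `[0, t] `[0, +oo[); first exact: subset_itvl.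
  move=> s; apply: cvg_sumr => p; apply: cvg_sumr => q; apply: cvgM.
    exact: cvg_cst.
  by apply: cvgM; exact: gram_flow_continuous.
- move=> s; rewrite in_itv /= => /andP[s0 _].
  apply: is_derive_sumr => p; apply: is_derive_sumr => q.
  have := gram_flow_derive p q s0 => HL.
  apply: (is_derive_eq (is_derive_mulr (is_derive_cst _ _ _) (is_derive_mulr HL HL))).
  by rewrite mulr0 addr0.
- move=> s sT; rewrite /dh.
  have bnd (F : 'I_N -> R) c : (forall i, F i <= c) -> \sum_i F i <= N%:R * c.
    move=> Fc; apply: le_trans (ler_sum _ (fun i _ => Fc i)) _.
    by rewrite sumr_const card_ord mulr_natl.
  rewrite -!mulrA; apply: (bnd) => p; apply: (bnd) => q.
  case: (eqVneq p q) => [_|pq]; rewrite /= ?mul0r ?mul1r.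
    by rewrite !mulr_ge0.
  have sI : s \in `[0, t].
    by move: sT; rewrite !in_itv /= => /andP[s0 st]; rewrite !ltW.
  have := le_trans (ler_norm _) (LC s p q sI pq); rewrite -/(dL s p q); lra.
- apply: big1 => p _; apply: big1 => q _.
  case: (eqVneq p q) => [_|pq]; first by rewrite mul0r.
  by move/is_diag_mxP: B0 => /(_ p q pq); rewrite -/(L 0) => ->; rewrite !mulr0.
Qed.

Let eig t : 'rV[R]_N := \row_i L t i i.

Lemma gram_flow_diagE t : 0 <= t -> L t = diag_mx (eig t).
Proof.
move=> /gram_flow_diagonal /is_diag_mxP Ld; apply/matrixP=> p q; rewrite [RHS]mxE.
by case: (eqVneq p q) => [->|/Ld ->]; rewrite ?mulr0n // mulr1n [RHS]mxE.
Qed.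

Let eig_ge0 t p : 0 <= eig t 0 p.
Proof. by rewrite mxE; exact: gram_diag_ge0. Qed.

Lemma gram_flow_coord_derive (t : R) p k : 0 < t ->
  is_derive t (1 : R) (fun s => B s p k)
    (- g * newton_eig m (eig t) p * B t p k).
Proof.
move=> t0; apply: (is_derive_eq (Bder p k t0)).
rewrite -/(L t) (gram_flow_diagE (ltW t0)) newton_mx_diag mul_diag_mx mxE.
by rewrite mxE mulrA.
Qed.

Lemma gram_flow_coord_cvg p k : cvg (B t p k @[t --> +oo]).
Proof.
apply: sqr_nonincreasing_cvg; first exact: Bcont.
have der (t : R) : 0 < t -> is_derive t (1 : R) (fun s => B s p k ^+ 2)
    (- (2 * g * newton_eig m (eig t) p * B t p k ^+ 2)).
  move=> t0; have HB := gram_flow_coord_derive p k t0.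
  apply: (is_derive_eq (is_derive_mulr HB HB)); ring.
move=> s t; apply: (@ler0_derive1_nincry R (fun s => B s p k ^+ 2) 0).
- by move=> u; rewrite in_itv /= andbT => /der[].
- move=> u; rewrite in_itv /= andbT derive1E => /der[_ ->].
  have := newton_eig_ge0 m p (eig_ge0 u); have := sqr_ge0 (B u p k).
  rewrite oppr_le0 => h1 h2; apply: mulr_ge0 => //; apply: mulr_ge0 => //.
  by apply: mulr_ge0 => //; exact: ltW.
- by move=> u; apply: cvgM; exact: Bcont.
Qed.

(** The eigenvalue L_pp has limit lambda and its derivative tends to
- 2 g lambda tau, which is 0 by [derive_pinfty_lim0]; the support of lambda is
then bounded by [card_support_newton_eig], and lambda_p = 0 means that row p
vanishes. *)
Lemma gram_flow_cvg : exists2 Binf : 'M[R]_(N, d),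
  forall p k, B t p k @[t --> +oo] --> Binf p k &
  (#|[set p | row p Binf != 0%R]%SET| <= m)%N.
Proof.
pose Binf : 'M[R]_(N, d) := \matrix_(p, k) lim (B t p k @[t --> +oo]).
have Blim p k : B t p k @[t --> +oo] --> Binf p k.
  by rewrite mxE; exact: gram_flow_coord_cvg.
exists Binf => //; pose Linf := Binf *m Binf^T.
have Llim p q : L t p q @[t --> +oo] --> Linf p q.
  under eq_cvg do rewrite L_entry; rewrite mxE.
  by apply: cvg_sumr => k; rewrite [Binf^T _ _]mxE; apply: cvgM.
pose einf : 'rV[R]_N := \row_i Linf i i.
have Linf_diag : Linf = diag_mx einf.
  apply/matrixP=> p q; rewrite [RHS]mxE; case: (eqVneq p q) => [->|pq].
    by rewrite mulr1n [RHS]mxE.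
  have L0 : L t p q @[t --> +oo] --> (0 : R).
    apply: cvg_near_cst; near=> t.
    by have /gram_flow_diagonal/is_diag_mxP : 0 <= t by []; exact.
  by rewrite mulr0n; exact: cvg_unique (Llim p q) L0.
have einf0 p : 0 <= einf 0 p by rewrite mxE; exact: gram_diag_ge0.
have eig0 p : einf 0 p * newton_eig m einf p = 0.
  have := @derive_pinfty_lim0 R (fun t => L t p p)
    (fun t => - (2 * g) * (newton_mx m (L t) *m L t) p p) (Linf p p)
    (- (2 * g) * (newton_mx m Linf *m Linf) p p).
  move=> /(_ (fun t => @gram_flow_derive t p p) (Llim p p)).
  have UL : - (2 * g) * (newton_mx m (L t) *m L t) p p @[t --> +oo] -->
      - (2 * g) * (newton_mx m Linf *m Linf) p p.
    apply: cvgM; first exact: cvg_cst.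
    under eq_cvg do rewrite mxE; rewrite mxE.
    by apply: cvg_sumr => r; apply: cvgM => //; exact: cvg_newton_mx.
  move=> /(_ UL) /eqP; rewrite Linf_diag newton_mx_diag mulmx_diag.
  rewrite mulf_eq0 oppr_eq0 mulf_eq0 pnatr_eq0 (gt_eqF g0) /= => /eqP.
  by rewrite [LHS]mxE eqxx mulr1n [LHS]mxE [X in X * _]mxE mulrC.
apply: leq_trans (card_support_newton_eig einf0 eig0).
apply/subset_leq_card/fintype.subsetP => p; rewrite !inE.
apply: contra_neq => p0; apply: sum_sqr_eq0.
transitivity (Linf p p); last by rewrite -[RHS]p0 [RHS]mxE.
by rewrite mxE [RHS]mxE; apply: eq_bigr => k _; rewrite !mxE.
Unshelve. all: by end_near. Qed.

End GramFlow.

(** * Convergence of the flow *)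

Lemma vspace_extension (K : fieldType) (vT : vectType K) (V : {vspace vT}) k :
  (\dim V <= k)%N -> (k <= \dim {:vT})%N ->
  exists2 W : {vspace vT}, (V <= W)%VS & \dim W = k.
Proof.
move=> Vk kT; pose Y := take (k - \dim V) (vbasis V^C%VS).
exists (V + <<Y>>)%VS; first exact: addvSl.
have VY : (V :&: <<Y>> = 0)%VS.
  apply/eqP; rewrite -subv0 -(capv_compl V); apply: capvS => //.
  apply/span_subvP => v /mem_take; exact: vbasis_mem.
have freeY : free Y.
  have := basis_free (vbasisP V^C%VS).
  by rewrite -[X in free X](cat_take_drop (k - \dim V)) => /catl_free.
rewrite dimv_disjoint_sum //; move: freeY; rewrite /free => /eqP ->.
rewrite size_takel ?subnKC // size_tuple dimv_compl leq_sub2r //.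
Qed.

Section Coordinates.
Variable R : realType.

Lemma cvg_rV_coord (T : Type) (F : set_system T) d (f : T -> 'rV[R]_d)
    (l : 'rV[R]_d) : Filter F ->
  (forall k, f t 0 k @[t --> F] --> l 0 k) -> f t @[t --> F] --> l.
Proof.
move=> FF fl; apply/cvgrPdist_le => /= e e0; near=> t.
rewrite /Num.Def.normr/= mx_normrE (bigmax_le _ (ltW e0))//= => -[i k] _.
rewrite !mxE ord1 /=; move: k; near: t; apply: filter_forall => /= k.
exact: ((cvgrPdist_le _ _).1 (fl k)).
Unshelve. all: by end_near. Qed.

Lemma is_derive_coord d (f : R -> 'rV[R]_d) (v : 'rV[R]_d) (t : R) k :
  is_derive t (1 : R) f v -> is_derive t (1 : R) (fun s => f s 0 k) (v 0 k).
Proof.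
move=> [df fv]; split; first by move/derivable_mxP : df; exact.
by rewrite -fv derive_mx // mxE.
Qed.

Lemma continuous_coord d (A : set R) (f : R -> 'rV[R]_d) k :
  {within A, continuous f} -> {within A, continuous (fun s => f s 0 k)}.
Proof.
move=> fc; apply: (@within_continuous_comp _ _ _ A f (fun v => v 0 k)) => //.
by move=> v _; exact: coord_continuous.
Qed.

Lemma derive0_constant (f : R -> R) : {within `[0, +oo[, continuous f} ->
  (forall t : R, 0 < t -> is_derive t (1 : R) f 0) ->
  forall t : R, 0 <= t -> f t = f 0.
Proof.
move=> fc fd t t0; apply/eqP; rewrite -subr_eq0; apply/eqP.
have [||c _ ->] := @MVT_segment R f (fun=> 0) 0 t t0; last by rewrite mul0r.
  by move=> s; rewrite in_itv /= => /andP[s0 _]; exact: fd.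
by apply: continuous_subspaceW fc; exact: subset_itvl.
Qed.

End Coordinates.

Section SimplexFlow.
Variables (R : realType) (d N m : nat) (kappa : R).
Variables (x0 : 'I_N -> 'rV[R]_d) (x : 'I_N -> R -> 'rV[R]_d).
Hypotheses (N0 : (0 < N)%N) (kappa0 : 0 < kappa).
Hypothesis hx : gradient_flow_solution m.+1 kappa x0 x.

Let X t := fun i => x i t.
Let A t := centered_mx (X t).
Let U t := newton_mx m (A t *m (A t)^T).
Let g := flow_rate N kappa m.+1.

Let centering_force t : @centering_mx R N *m (U t *m A t) = U t *m A t.
Proof. by rewrite mulmxA; exact: centering_newton. Qed.

Lemma flow_rate_gt0 : 0 < g.
Proof.
rewrite /g /flow_rate divr_gt0 ?mulr_gt0 ?exprn_gt0 ?ltr0n ?fact_gt0 //.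
Qed.

Lemma simplex_flow_continuous i k :
  {within `[0, +oo[, continuous (fun t => x i t 0 k)}.
Proof. by apply: continuous_coord; have [] := hx i. Qed.

Lemma simplex_flow_derive (t : R) i k : 0 < t ->
  is_derive t (1 : R) (fun s => x i s 0 k) (- g * (U t *m A t) i k).
Proof.
move=> t0; have [_ _ /(_ t t0)/(is_derive_coord k) der] := hx i.
apply: (is_derive_eq der).
transitivity ((- row i (g *: (U t *m A t))) 0 k).
  by rewrite -(gradient_simplex_potential m kappa (X t) i N0).
by move: (U t *m A t) => Z; rewrite !mxE mulNr.
Qed.

Lemma linear_image_continuous (S : 'M[R]_N) p k :
  {within `[0, +oo[, continuous (fun t => (S *m point_mx (X t)) p k)}.
Proof.
have -> : (fun t => (S *m point_mx (X t)) p k) = fun t => \sum_j S p j * x j t 0 k.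
  by apply/funext => t; rewrite mxE; apply: eq_bigr => j _; rewrite mxE.
move=> t; apply: cvg_sumr => j; apply: cvgM; first exact: cvg_cst.
exact: simplex_flow_continuous.
Qed.

Lemma linear_image_derive (S : 'M[R]_N) (t : R) p k : 0 < t ->
  is_derive t (1 : R) (fun s => (S *m point_mx (X s)) p k)
    (- g * (S *m (U t *m A t)) p k).
Proof.
move=> t0.
have -> : (fun t => (S *m point_mx (X t)) p k) = fun t => \sum_j S p j * x j t 0 k.
  by apply/funext => s; rewrite mxE; apply: eq_bigr => j _; rewrite mxE.
have der := is_derive_sumr (fun j => is_derive_mulr (is_derive_cst (S p j) t 1)
  (simplex_flow_derive j k t0)).
apply: (is_derive_eq der); rewrite [in RHS]mxE mulr_sumr; apply: eq_bigr => j _.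
by rewrite mulr0 addr0 mulrCA.
Qed.

(** The complementary projection of the velocity is 0, so the difference between
a position and its centered value keeps its initial value, the initial
mean. *)
Lemma positionE_centered (t : R) i k : 0 <= t ->
  x i t 0 k = A t i k + (N%:R^-1 *: \sum_j x0 j) 0 k.
Proof.
move=> t0; pose S : 'M[R]_N := 1%:M - @centering_mx R N.
have SE s : (S *m point_mx (X s)) i k = x i s 0 k - A s i k.
  by rewrite mulmxBl mul1mx -/(centered_mx (X s)) -/(A s) 2!mxE [X in _ + X]mxE.
have : (S *m point_mx (X t)) i k = (S *m point_mx (X 0)) i k.
  apply: (@derive0_constant R (fun s => (S *m point_mx (X s)) i k)) => //.
    exact: linear_image_continuous.
  move=> s s0; apply: (is_derive_eq (linear_image_derive S i k s0)).
  by rewrite mulmxBl mul1mx centering_force subrr mxE mulr0.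
have X0 : X 0 = x0 by apply/funext => j; have [] := hx j.
rewrite !SE /A [X in _ = _ - X]centered_mxE X0 -[x i 0]/(X 0 i) X0 [in RHS]mxE.
rewrite [X in _ - (_ + X)]mxE => /eqP; rewrite subr_eq => /eqP ->.
by rewrite opprD opprK addrA subrr add0r addrC.
Qed.

(** In the eigenbasis Q of the initial Gram matrix the flow becomes the flow of
[gram_flow_cvg]; rotating back, the limits are combinations of the nonzero rows
of the limit of B. *)
Theorem simplex_flow_cvg : exists (c : 'rV[R]_d) (Y : 'M[R]_(N, d))
    (V : {vspace 'rV[R]_d}),
  [/\ (\dim V <= m)%N, (forall i, row i Y \in V) &
      forall i, x i t @[t --> +oo] --> row i Y + c].
Proof.
have [|Q QQ Qd] := @real_spectral R N (A 0 *m (A 0)^T).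
  by rewrite trmx_mul trmxK.
have QQ' := mulmx1C QQ.
pose B t := (Q *m @centering_mx R N) *m point_mx (X t).
have BA t : B t = Q *m A t by rewrite /B -mulmxA.
have BB t : B t *m (B t)^T = Q *m (A t *m (A t)^T) *m Q^T.
  by rewrite BA trmx_mul !mulmxA.
have [] := @gram_flow_cvg R N d m g B flow_rate_gt0.
- by move=> p k; exact: linear_image_continuous.
- move=> t p k t0; apply: (is_derive_eq (linear_image_derive _ p k t0)).
  rewrite BB newton_mx_conj // BA; congr (_ * _).
  rewrite -/(U t) -[(Q *m _) *m (U t *m _)]mulmxA centering_force.
  by rewrite -!mulmxA (mulmxA Q^T) QQ' mul1mx.
- by rewrite BB.
move=> Binf Blim Bcard.
pose S := [set p | row p Binf != 0%R]%SET.
exists (N%:R^-1 *: \sum_j x0 j), (Q^T *m Binf), <<[seq row p Binf | p <- enum S]>>%VS.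
split.
- by apply: leq_trans (dim_span _) _; rewrite size_map -cardE.
- move=> i; rewrite row_mul mulmx_sum_row rpred_sum // => p _; apply: rpredZ.
  have [->|p0] := eqVneq (row p Binf) 0; first exact: rpred0.
  by apply/memv_span/map_f; rewrite mem_enum inE.
- move=> i; apply: cvg_rV_coord => k.
  have -> : (row i (Q^T *m Binf) + N%:R^-1 *: \sum_j x0 j) 0 k =
      \sum_p Q p i * Binf p k + (N%:R^-1 *: \sum_j x0 j) 0 k.
    rewrite mxE; congr (_ + _); rewrite !mxE.
    by apply: eq_bigr => p _; rewrite mxE.
  have lim : \sum_p Q p i * B t p k + (N%:R^-1 *: \sum_j x0 j) 0 k
      @[t --> +oo] --> \sum_p Q p i * Binf p k + (N%:R^-1 *: \sum_j x0 j) 0 k.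
    apply: cvgD; last exact: cvg_cst.
    by apply: cvg_sumr => p; apply: cvgM; [exact: cvg_cst | exact: Blim].
  apply: cvg_trans lim; apply: near_eq_cvg; near=> t.
  rewrite positionE_centered //; congr (_ + _).
  have -> : A t = Q^T *m B t by rewrite BA mulmxA QQ' mul1mx.
  by rewrite [RHS]mxE; apply: eq_bigr => p _; rewrite [Q^T _ _]mxE.
Unshelve. all: by end_near. Qed.

End SimplexFlow.

Unset Implicit Arguments.

Theorem theorem3p1 (R : realType) (d N n : nat) (kappa : R)
    (x0 : 'I_N -> 'rV[R]_d) (x : 'I_N -> R -> 'rV[R]_d)
    (hd : (1 <= d)%N) (hN : (1 <= N)%N) (hn : (1 <= n <= d.+1)%N)
    (hkappa : 0 < kappa)
    (hx : gradient_flow_solution n kappa x0 x) :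
  exists P : set 'rV[R]_d,
    affine_subspace n.-1 P /\
    forall i : 'I_N,
      exists2 xinf : 'rV[R]_d, x i t @[t --> +oo] --> xinf & P xinf.
Proof.
case: n hn hx => [//|m] /= md hx.
have [c [Y [V [Vm YV xlim]]]] := simplex_flow_cvg hN hkappa hx.
have [|W VW Wm] := vspace_extension Vm.
  by rewrite dimvf /dim /= mul1n.
exists [set y | y - c \in W]; split; first by exists c, W.
move=> i; exists (row i Y + c); first exact: xlim.
by rewrite /= addrK (subvP VW).
Qed.
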